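(* Let $n\ge2$, $L\ge0$, $j,k\in\{0,\dots,n-1\}$, and let $r\in\{1,\dots,n\}$ be determined by $L+j-2k\equiv r\pmod n$. Then $$F_L(\Lambda_0+\Lambda_j,\Lambda_k)=\sum_{\vec m}q^{\vec m^{\,t}C^{-1}\vec m-\vec m^{\,t}C^{-1}\vec e_{n-j}}\prod_{i=1}^{n-1}\begin{bmatrix}\ell_i+m_i\\ m_i\end{bmatrix}_q,\qquad \vec\ell=C^{-1}\big(L\,\vec e_{n-1}+\vec e_r+\vec e_{n-j}-2\vec m\big),$$ where the sum is over all $\vec m=(m_1,\dots,m_{n-1})^t\in\mathbb{Z}_{\ge0}^{n-1}$ with $k+\sum_{i=1}^{n-1}i\,m_i\equiv0\pmod n$.
   Context: $\Lambda_0,\dots,\Lambda_{n-1}$ are the fundamental weights of $\widehat{sl(n)}$, indices taken modulo $n$; $\hat i=\Lambda_{i+1}-\Lambda_i$ (the $n$ weights $\hat0,\dots,\widehat{n-1}$ are distinct); $P_2^+=\{\Lambda_a+\Lambda_b\}$. A path is $p=(\lambda_0,\dots,\lambda_L)$ with all $\lambda_\ell\in P_2^+$, $\lambda_{\ell+1}-\lambda_\ell\in\{\hat0,\dots,\widehat{n-1}\}$, $\lambda_0=\Lambda_0+\Lambda_j$, $\lambda_L=\Lambda_k+\Lambda_{j-k+L}$. Set $\lambda_{L+1}=\Lambda_k+\Lambda_{j-k+L+1}$ and define $\mu_\ell\in\{0,\dots,n-1\}$ by $\widehat{\mu_\ell}=\lambda_{\ell+1}-\lambda_\ell$ ($0\le\ell\le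 L$). A domain wall of height $h\in\{1,\dots,n-1\}$ sits at position $\ell\in\{1,\dots,L\}$ if $\mu_\ell-\mu_{\ell-1}\equiv h+1\pmod n$. If the domain walls are at $x_1<\dots<x_N$ with heights $h_1,\dots,h_N$, the associated K-graph has $|G(p)|=\sum_{a=1}^N h_a x_a$ nodes, and $F_L(\Lambda_0+\Lambda_j,\Lambda_k)=\sum_p q^{|G(p)|/n}$ over all such paths. $C$ is the Cartan matrix of $sl(n)$ ($C_{ij}=2\delta_{ij}-\delta_{i,j-1}-\delta_{i,j+1}$, $1\le i,j\le n-1$), with $(C^{-1})_{ij}=i(n-j)/n$ for $i\le j$ and $j(n-i)/n$ for $i>j$. $\vec e_i$ is the $i$-th unit vector in $\mathbb{R}^{n-1}$ for $1\le i\le n-1$, and $\vec e_n$ denotes the zero vector. $\begin{bmatrix}N\\ m\end{bmatrix}_q=\frac{(q)_N}{(q)_m(q)_{N-m}}$ for $0\le m\le N$ and $0$ otherwise, $(q)_m=\prod_{s=1}^m(1-q^s)$. *)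

(* Defs.v *)
From mathcomp Require Import all_boot all_order all_algebra.
Import Order.TTheory GRing.Theory Num.Theory.
Local Open Scope ring_scope.

(* A weight sum_i c_i Lambda_i is represented by its coefficient vector
   i |-> c_i, with i : 'I_n.  Fundamental weight Lambda_a, index a mod n. *)
Definition Lam (n : nat) (a : int) : 'I_n -> int :=
  fun i => if (i%:Z == (a %% n%:Z)%Z) then 1 else 0.

Definition hat (n : nat) (a : int) : 'I_n -> int :=
  fun i => Lam n (a + 1) i - Lam n a i.

Definition eqw (n : nat) (u v : 'I_n -> int) : bool := [forall i, u i == v i].
Definition addw (n : nat) (u v : 'I_n -> int) : 'I_n -> int := fun i => u i + v i.
Definition subw (n : nat) (u v : 'I_n -> int) : 'I_n -> int := fun i => u i - v i.

Definition inP2 (n : nat) (w : 'I_n -> int) : bool :=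
  [exists a : 'I_n, exists b : 'I_n, eqw n w (addw n (Lam n a) (Lam n b))].

(* Every element of P_2^+ has coefficients in {0,1,2}, so a candidate
   sequence lambda_0..lambda_L is encoded as a finite function
   'I_(L+1) -> ('I_n -> 'I_3). *)
Definition wcode (n : nat) := {ffun 'I_n -> 'I_3}.
Definition wt (n : nat) (w : wcode n) : 'I_n -> int := fun i => (w i : nat)%:Z.
Definition pcode (n L : nat) := {ffun 'I_L.+1 -> wcode n}.

Definition lamx (n L j k : nat) (p : pcode n L) (l : nat) : 'I_n -> int :=
  if (l <= L)%N then wt n (p (inord l))
  else addw n (Lam n k%:Z) (Lam n (j%:Z - k%:Z + L%:Z + 1)).

Definition is_path (n L j k : nat) (p : pcode n L) : bool :=
  [&& [forall l : 'I_L.+1, inP2 n (wt n (p l))],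
      [forall l : 'I_L, [exists mu : 'I_n,
          eqw n (subw n (lamx n L j k p l.+1) (lamx n L j k p l)) (hat n mu)]],
      eqw n (lamx n L j k p 0) (addw n (Lam n 0) (Lam n j%:Z)) &
      eqw n (lamx n L j k p L) (addw n (Lam n k%:Z) (Lam n (j%:Z - k%:Z + L%:Z)))].

Definition mu (n L j k : nat) (p : pcode n L) (l : nat) : nat :=
  match [pick m : 'I_n | eqw n (subw n (lamx n L j k p l.+1) (lamx n L j k p l)) (hat n m)] with
  | Some m => (m : nat)
  | None => 0%N
  end.

(* |G(p)| = sum over domain walls (position x in 1..L, height h in 1..n-1,
   mu_x - mu_{x-1} = h+1 mod n) of h * x *)
Definition Gsize (n L j k : nat) (p : pcode n L) : nat :=
  (\sum_(1 <= x < L.+1)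
     \sum_(1 <= h < n |
        ((mu n L j k p x)%:Z - (mu n L j k p x.-1)%:Z == h%:Z + 1 %[mod n%:Z])%Z)
       (h * x))%N.

(* coefficient of q^e (e rational) in F_L(Lambda_0+Lambda_j, Lambda_k)
   = number of paths p with |G(p)|/n = e *)
Definition FL_coef (n L j k : nat) (e : rat) : rat :=
  (\sum_(p : pcode n L | is_path n L j k p && ((Gsize n L j k p)%:R / n%:R == e)) 1%N)%:R.

(* Cartan matrix of sl(n), indices 1..n-1 represented by 'I_(n-1) (shift by 1) *)
Definition Cartan (n : nat) : 'M[rat]_(n.-1) :=
  \matrix_(a, b) (if a == b then 2
                  else if (a.+1 == b :> nat) || (b.+1 == a :> nat) then -1 else 0).

Definition Cinv (n : nat) : 'M[rat]_(n.-1) := invmx (Cartan n).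

(* unit vector e_i (1 <= i <= n-1); e_n (and any out-of-range i) is zero *)
Definition evec (n i : nat) : 'cV[rat]_(n.-1) := \col_t (if t.+1 == i then 1 else 0).

Definition mvec (n : nat) (m : 'I_n.-1 -> nat) : 'cV[rat]_(n.-1) := \col_t (m t)%:R.

Definition qpoch (N : nat) : {poly rat} := \prod_(1 <= s < N.+1) (1 - 'X^s).

(* q-binomial [N; m]_q = (q)_N / ((q)_m (q)_(N-m)) for 0 <= m <= N, else 0;
   the quotient is exact polynomial division. *)
Definition qbin (N m : nat) : {poly rat} :=
  if (m <= N)%N then qpoch N %/ (qpoch m * qpoch (N - m)) else 0.

(* q-binomial with an a priori rational top entry (it is a nonnegative
   integer whenever the binomial is nonzero) *)
Definition qbinQ (N : rat) (m : nat) : {poly rat} :=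
  if N \is a Num.nat then qbin (Num.truncn N) m else 0.

Definition ellv (n L j r : nat) (m : 'I_n.-1 -> nat) : 'cV[rat]_(n.-1) :=
  Cinv n *m (L%:R *: evec n n.-1 + evec n r + evec n (n - j) - 2%:R *: mvec n m).

Definition expo (n j : nat) (m : 'I_n.-1 -> nat) : rat :=
  ((mvec n m)^T *m Cinv n *m mvec n m - (mvec n m)^T *m Cinv n *m evec n (n - j)) ord0 ord0.

Definition qprod (n L j r : nat) (m : 'I_n.-1 -> nat) : {poly rat} :=
  \prod_(i < n.-1) qbinQ (ellv n L j r m i ord0 + (m i)%:R) (m i).

(* coefficient of q^e in the summand q^{expo m} * qprod m *)
Definition term_coef (n L j r : nat) (m : 'I_n.-1 -> nat) (e : rat) : rat :=
  let d := e - expo n j m in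
  if d \is a Num.nat then (qprod n L j r m)`_(Num.truncn d) else 0.

Definition RHS_box_coef (n L j k r N : nat) (e : rat) : rat :=
  \sum_(m : {ffun 'I_n.-1 -> 'I_N} |
          ((k + \sum_(i < n.-1) i.+1 * m i) %% n == 0)%N)
     term_coef n L j r (fun i => (m i : nat)) e.

(* Main.v *)
(* Write F_L(kap) for the path sum and G(v, kap) for the fermionic sum with a
   general integer source vector v (so l = C^-1 (v - 2m)), the charge condition
   being kap + sum_i i m_i = 0 mod n.

   Removing the last step of a path gives, with r = L + j - 2 kap mod n,
     F_L(kap) = F_(L-1)(kap) + [r <> 0] q^(r L / n) F_(L-1)(j - kap + L).
   Pascal's rule for the s-th binomial reads, as soon as v_s > 0,
     G(v, kap) = G(v - C e_s, kap) + q^c G(v - 2 e_s, kap + s).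
   Applied for s = n-1, ..., r to v = L e_(n-1) + e_r + e_(n-j), and for
   s = r+1, ..., n-1 to v = (L-1) e_(n-1) + e_(r+1) + e_(n-j), it produces the
   same correction terms apart from one, and comparing them yields a recurrence with three
   terms in L which also follows from the path recurrence.  Both sides agree
   at L = 0, where only m = 0 and m = e_(n-j) contribute. *)
Require Import Defs.
From mathcomp Require Import all_boot all_order all_algebra.
From mathcomp Require Import zify ring.
Import Order.TTheory GRing.Theory Num.Theory.
Local Open Scope ring_scope.

Set Implicit Arguments.
Unset Strict Implicit.
Unset Printing Implicit Defensive.

(** * Gaussian binomials defined by Pascal's rule *)

(* [gauss q l m] is the Gaussian binomial of [l + m] over [m]. *)
Fixpoint gauss (R : comNzRingType) (q : R) (l : nat) : nat -> R :=
  match l with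
  | 0%N => fun _ => 1
  | l'.+1 =>
    fix gauss_l m := match m with
                     | 0%N => 1
                     | m'.+1 => gauss q l' m'.+1 + q ^+ l'.+1 * gauss_l m'
                     end
  end.

Lemma gauss0m (R : comNzRingType) (q : R) m : gauss q 0 m = 1.
Proof. by []. Qed.

Lemma gaussl0 (R : comNzRingType) (q : R) l : gauss q l 0 = 1.
Proof. by case: l. Qed.

Lemma gaussSS (R : comNzRingType) (q : R) l m :
  gauss q l.+1 m.+1 = gauss q l m.+1 + q ^+ l.+1 * gauss q l.+1 m.
Proof. by []. Qed.

Lemma rmorph_gauss (R S : comNzRingType) (f : {rmorphism R -> S}) (q : R) l m :
  f (gauss q l m) = gauss (f q) l m.
Proof.
elim: l m => [|l IHl] m; first by rewrite !gauss0m rmorph1.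
elim: m => [|m IHm]; first by rewrite !gaussl0 rmorph1.
by rewrite !gaussSS rmorphD rmorphM rmorphXn IHl IHm.
Qed.

Lemma dvdz_small (n : nat) (x : int) :
  (n%:Z %| x)%Z -> - n%:Z < x -> x < n%:Z -> x = 0.
Proof. by move=> /dvdzP[c ->] h1 h2; have -> : c = 0 by nia. Qed.

(** * The inverse Cartan matrix of sl(n), cleared of denominators *)

(* [n] times the inverse Cartan matrix, with 1-based indices; it vanishes at
   the fictitious indices [0] and [n]. *)
Definition nCinv (n i s : nat) : int := (minn i s * (n - maxn i s))%N%:Z.

Definition dl (s i : nat) : int := (i == s)%:Z.

Lemma nCinvC n i s : nCinv n i s = nCinv n s i.
Proof. by rewrite /nCinv minnC maxnC. Qed.

Lemma nCinv_le n i s : (i <= s <= n)%N -> nCinv n i s = i%:Z * (n%:Z - s%:Z).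
Proof.
move=> /andP[le_is le_sn].
by rewrite /nCinv (minn_idPl le_is) (maxn_idPr le_is) PoszM subzn.
Qed.

Lemma nCinv_ge n i s : (s <= i <= n)%N -> nCinv n i s = s%:Z * (n%:Z - i%:Z).
Proof. by move=> h; rewrite nCinvC nCinv_le. Qed.

Lemma nCinv0 n i : nCinv n i 0 = 0.
Proof. by rewrite /nCinv minn0. Qed.

Lemma nCinvn n i : (i <= n)%N -> nCinv n i n = 0.
Proof. by move=> le_in; rewrite /nCinv (maxn_idPr le_in) subnn muln0. Qed.

(** In its second index [nCinv n i] is piecewise linear, with slope [n - i] before [i] and [- i]
    after it, so its second difference is concentrated at [i]. *)
Lemma nCinv_Cartan n i s : (i <= n)%N -> (s.+1 < n)%N ->
  2 * nCinv n i s.+1 - nCinv n i s - nCinv n i s.+2 = n%:Z * dl s.+1 i.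
Proof.
move=> le_in lt_sn; rewrite /dl; have [lt_is|ge_is] := boolP (i < s.+1)%N.
  have -> : (i == s.+1) = false by lia.
  by rewrite !nCinv_le /=; lia.
have [->|/eqP i_s] := eqVneq i s.+1.
  by rewrite nCinv_le ?[nCinv _ _ s]nCinv_ge ?[nCinv _ _ s.+2]nCinv_le /=; lia.
by rewrite !nCinv_ge; lia.
Qed.

Lemma dl_top n i : (0 < i < n)%N -> dl n i = 0.
Proof. by move=> hi; rewrite /dl; case: eqP => //; lia. Qed.

(** The cases [s = 0] and [s = n] are consistent because [nCinv] vanishes there; hence [e_0] and
    [e_n] act as zero vectors without separate treatment. *)
Lemma sum_nCinv_dl n i s : (i <= n)%N -> (s <= n)%N ->
  \sum_(x < n.-1) nCinv n i x.+1 * dl s x.+1 = nCinv n i s.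
Proof.
move=> le_in le_sn; have [s0|s_n0] := posnP s.
  by rewrite s0 nCinv0 big1 // => x _; rewrite /dl mulr0.
have [lt_sn|ge_sn] := ltnP s n; last first.
  have -> : s = n by lia.
  rewrite nCinvn // big1 // => x _; rewrite /dl.
  have hx := ltn_ord x; have -> : (x.+1 == n) = false by apply/eqP; lia.
  by rewrite mulr0.
have hs : (s.-1 < n.-1)%N by lia.
rewrite (bigD1 (Ordinal hs)) //= big1 => [|x /eqP nx].
  by rewrite /dl prednK // eqxx mulr1 addr0.
rewrite /dl; have -> : (x.+1 == s) = false; last by rewrite mulr0.
by apply/negP => /eqP xs; apply: nx; apply: val_inj => /=; lia.
Qed.

(** * The fermionic sum *)

Section Fermionic.

Variable n : nat.
Hypothesis n_ge2 : (2 <= n)%N.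

Implicit Types (v : nat -> int) (m : 'I_n.-1 -> nat) (kap : int).

(* [n] times the vector [l = C^-1 (v - 2 m)]. *)
Definition ellnum v m (i : nat) : int :=
  \sum_(x < n.-1) nCinv n i x.+1 * (v x.+1 - 2 * (m x)%:Z).

(* [n] times the exponent of [q], with [e_a] in place of [e_(n-j)]. *)
Definition nexpo (a : nat) m : int :=
  \sum_(x < n.-1) \sum_(y < n.-1) nCinv n x.+1 y.+1 * ((m x)%:Z * (m y)%:Z)
  - \sum_(x < n.-1) nCinv n x.+1 a * (m x)%:Z.

Definition charge kap m : int := kap + \sum_(x < n.-1) (x.+1 * m x)%N%:Z.

Definition incr (s : 'I_n.-1) m : 'I_n.-1 -> nat := fun x => (m x + (x == s))%N.

(** The vector [C e_s], a column of the Cartan matrix, with 1-based indices. *)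
Definition Cdl (s : nat) : nat -> int :=
  fun i => 2 * dl s i - dl s.-1 i - dl s.+1 i.

Lemma sum_incr (s : 'I_n.-1) m (f : 'I_n.-1 -> int) :
  \sum_x f x * (incr s m x)%:Z = \sum_x f x * (m x)%:Z + f s.
Proof.
rewrite (bigD1 s) //= [in RHS](bigD1 s) //= /incr eqxx.
rewrite (eq_bigr (fun x => f x * (m x)%:Z)) => [|x /negPf ->]; last by rewrite addn0.
by rewrite PoszD /=; ring.
Qed.

Lemma sum_ord_eq (s : 'I_n.-1) (f : 'I_n.-1 -> int) :
  \sum_x f x * (x == s)%:Z = f s.
Proof.
rewrite (bigD1 s) //= eqxx mulr1 big1 ?addr0 // => x /negPf ->.
by rewrite mulr0.
Qed.

Lemma charge_incr s m kap : charge kap (incr s m) = charge (kap + s.+1%:Z) m.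
Proof.
rewrite /charge.
under eq_bigr do rewrite PoszM.
by rewrite sum_incr; under [in RHS]eq_bigr do rewrite PoszM; ring.
Qed.

Lemma nexpo_incr a s m : nexpo a (incr s m) =
  nexpo a m + 2 * \sum_(x < n.-1) nCinv n s.+1 x.+1 * (m x)%:Z
  + nCinv n s.+1 s.+1 - nCinv n s.+1 a.
Proof.
rewrite /nexpo sum_incr.
have row (x : 'I_n.-1) : \sum_(y < n.-1) nCinv n x.+1 y.+1 * ((incr s m x)%:Z * (incr s m y)%:Z)
    = (\sum_(y < n.-1) nCinv n x.+1 y.+1 * (m y)%:Z + nCinv n x.+1 s.+1)
      * (incr s m x)%:Z.
  under eq_bigr => y _ do rewrite mulrCA mulrC.
  by rewrite -mulr_suml sum_incr.
under eq_bigr do rewrite row.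
rewrite sum_incr.
under eq_bigr => x _ do rewrite mulrDl.
rewrite big_split /=.
have -> : \sum_(i < n.-1) nCinv n i.+1 s.+1 * (m i)%:Z
  = \sum_(i < n.-1) nCinv n s.+1 i.+1 * (m i)%:Z.
  by apply: eq_bigr => i _; rewrite nCinvC.
have -> : \sum_(x < n.-1) \sum_(y < n.-1) nCinv n x.+1 y.+1 * ((m x)%:Z * (m y)%:Z)
  = \sum_(i < n.-1) (\sum_(y < n.-1) nCinv n i.+1 y.+1 * (m y)%:Z) * (m i)%:Z.
  apply: eq_bigr => x _; rewrite mulr_suml; apply: eq_bigr => y _; ring.
ring.
Qed.

Lemma ellnumE v m i : ellnum v m i =
  \sum_(x < n.-1) nCinv n i x.+1 * v x.+1
  - 2 * \sum_(x < n.-1) nCinv n i x.+1 * (m x)%:Z.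
Proof.
rewrite /ellnum mulr_sumr -sumrB; apply: eq_bigr => x _; ring.
Qed.

Lemma ellnum_incr v s m i :
  ellnum v (incr s m) i = ellnum (fun x => v x - 2 * dl s.+1 x) m i.
Proof.
apply: eq_bigr => x _; rewrite /incr /dl eqSS PoszD.
rewrite -[x == s]/(x == s :> nat); ring.
Qed.

(** By [C^-1 C = 1], subtracting [C e_s] from the source changes [l_s] alone. This makes it possible
    to apply Pascal's rule to a single binomial of the product. *)
Lemma ellnum_Cdl v m (i s : 'I_n.-1) :
  ellnum (fun x => v x - Cdl s.+1 x) m i.+1 = ellnum v m i.+1 - n%:Z * (i == s)%:Z.
Proof.
have hi := ltn_ord i; have hs := ltn_ord s.
have le_in : (i.+1 <= n)%N by lia.
have <- : n%:Z * dl s.+1 i.+1 = n%:Z * (i == s)%:Z.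
  by rewrite /dl eqSS.
rewrite -nCinv_Cartan //; last by lia.
rewrite -!(@sum_nCinv_dl n i.+1) //; try lia.
rewrite /ellnum mulr_sumr -!sumrB; apply: eq_bigr => x _.
by rewrite /Cdl /=; ring.
Qed.

(** This is [C l = v - 2 m] multiplied by [n]; it turns the signs of the neighbours of [l_s] into a
    condition on [l_s]. *)
Lemma ellnum_second_difference v m (s : 'I_n.-1) :
  2 * ellnum v m s.+1 - ellnum v m s - ellnum v m s.+2
  = n%:Z * (v s.+1 - 2 * (m s)%:Z).
Proof.
have hs := ltn_ord s.
rewrite /ellnum mulr_sumr -!sumrB.
rewrite -[RHS](sum_ord_eq s (fun x => n%:Z * (v x.+1 - 2 * (m x)%:Z))).
apply: eq_bigr => x _; have hx := ltn_ord x.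
have -> : (x == s)%:Z = dl s.+1 x.+1 by rewrite /dl eqSS.
rewrite [RHS]mulrAC -nCinv_Cartan; try lia.
rewrite ![nCinv n x.+1 _]nCinvC; ring.
Qed.

Lemma ellnum_edge v m i : i = 0%N \/ i = n -> ellnum v m i = 0.
Proof.
move=> hi; rewrite /ellnum big1 // => x _; have hx := ltn_ord x.
by case: hi => ->; rewrite nCinvC ?nCinv0 ?nCinvn ?mul0r //; lia.
Qed.

(** In each column the first and last rows of [nCinv] add up to [n]. The identity serves to bound
    the support of the sum. *)
Lemma ellnum_ends v m :
  ellnum v m 1 + ellnum v m n.-1 = n%:Z * \sum_(x < n.-1) (v x.+1 - 2 * (m x)%:Z).
Proof.
rewrite /ellnum -big_split mulr_sumr; apply: eq_bigr => x _; have hx := ltn_ord x.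
rewrite /= -mulrDl; congr (_ * _).
by rewrite nCinv_le ?[nCinv _ n.-1 _]nCinv_ge; lia.
Qed.

Lemma sum_dl p : \sum_(x < n.-1) dl p x.+1 = ((0 < p) && (p < n))%N%:Z.
Proof.
case: p => [|p]; first by rewrite big1.
have [lt_pn|ge_pn] := ltnP p.+1 n.
  have hp : (p < n.-1)%N by lia.
  rewrite (bigD1 (Ordinal hp)) //= /dl eqxx big1 ?addr0 // => x /negPf.
  by rewrite eqSS -[x == _]/(x == p :> nat) => ->.
rewrite big1 // => x _; have hx := ltn_ord x; rewrite /dl.
by have -> : (x.+1 == p.+1) = false by apply/eqP; lia.
Qed.

(** [n] times the exponent [c] in Pascal's rule. The change of the quadratic exponent and the power
    [q ^ l_s] both depend on [m], but these dependences cancel. *)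
Definition pascal_expo a v (s : nat) : int :=
  \sum_(x < n.-1) nCinv n s x.+1 * v x.+1 - nCinv n s a - nCinv n s s.

(* The source [L e_(n-1) + e_r + e_a], used with [a = n - j]; the length [L]
   may be [-1] in the recurrence. *)
Definition srcv (a : nat) (L : int) (r : nat) : nat -> int :=
  fun i => L * dl n.-1 i + dl r i + dl a i.

(** The summand [e_a] of the source cancels the linear term of the exponent, so the result is free
    of [a]. *)
Lemma pascal_expo_srcv a c r p q s : (a <= n)%N -> (r <= n)%N -> (p <= n)%N ->
  (q <= n)%N -> (s <= n)%N ->
  pascal_expo a (fun i => srcv a c r i + dl p i - dl q i) s =
  c * nCinv n s n.-1 + nCinv n s r + nCinv n s p - nCinv n s q - nCinv n s s.
Proof.
move=> ha hr hp hq hs.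
rewrite /pascal_expo -!(@sum_nCinv_dl n s) //; last by lia.
rewrite mulr_sumr -!big_split -!sumrB /=.
by apply: eq_bigr => x _; rewrite /srcv; ring.
Qed.

(* Source and exponent of the [s]-th correction term common to both chains of
   Pascal steps. *)
Definition chainv a L r s : nat -> int :=
  fun i => srcv a L r i - dl n.-1 i - dl s i - dl s.+1 i.

Definition chain_expo L r s : int :=
  (L - 1) * s%:Z + r%:Z * (n%:Z - s%:Z) - s%:Z * (n%:Z - s%:Z - 1).

Lemma ellnum_unit a r (s : 'I_n.-1) m i : (a <= n)%N -> (r <= n)%N -> (i <= n)%N ->
  m =1 (fun x => (x == s) : nat) ->
  ellnum (srcv a 0 r) m i = nCinv n i r + nCinv n i a - 2 * nCinv n i s.+1.
Proof.
move=> ha hr hi mE; have hs := ltn_ord s.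
rewrite -!(@sum_nCinv_dl n i) //; last by lia.
rewrite mulr_sumr -big_split -sumrB; apply: eq_bigr => x _ /=.
by rewrite mE /srcv [dl s.+1 _]/dl eqSS -[x == s]/(x == s :> nat); ring.
Qed.

(** The concave function [nCinv n i] has its kink at [i], so its mean over two points symmetric
    about [i] is strictly below its value at [i] unless both points are [i]. *)
Lemma nCinv_midpoint i r a : (0 < i < n)%N -> (r + a = 2 * i)%N ->
  (r <= n)%N -> (a <= n)%N ->
  0 <= nCinv n i r + nCinv n i a - 2 * nCinv n i i -> r = i /\ a = i.
Proof.
wlog le_ra : r a / (r <= a)%N => [W|].
  move=> hi hra hr ha; case/orP: (leq_total r a) => le_ra; first exact: W.
  by rewrite [nCinv n i r + _]addrC => h; case: (W a r) => //; lia.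
move=> hi hra hr ha; rewrite nCinv_ge ?[nCinv _ _ a]nCinv_le ?[nCinv _ i i]nCinv_le; try lia.
have -> : r%:Z = 2 * i%:Z - a%:Z by lia.
move=> h; suff : (a%:Z - i%:Z) * n%:Z <= 0 by nia.
by lia.
Qed.

(** * Summands of the fermionic sum, with [t] in the role of [q^(1/n)] *)

Variables (K : fieldType) (t : K).

(* The binomial vanishes unless [x / n] is a nonnegative integer. *)
Definition gnum (x : int) (m : nat) : K :=
  if (n%:Z %| x)%Z && (0 <= x) then gauss (t ^+ n) `|(x %/ n%:Z)%Z|%N m else 0.

(** With [x = n l] one has [t ^ x = q ^ l], so this is Pascal's rule. The value 0 for negative [l]
    also makes it hold at [l = 0], where both binomials over [m] and [m + 1] are 1. *)
Lemma gnumS (x : int) (m : nat) : gnum x m.+1 = gnum (x - n%:Z) m.+1 + t ^ x * gnum x m.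
Proof.
rewrite /gnum rpredBr ?dvdzz //.
case: (boolP (n%:Z %| x)%Z) => [/dvdzP[l ->{x}]|_]; last by rewrite mulr0 addr0.
have n0 : n%:Z != 0 by lia.
have -> : l * n%:Z - n%:Z = (l - 1) * n%:Z by ring.
rewrite !mulzK //=.
have -> : (0 <= l * n%:Z) = (0 <= l) by nia.
have -> : (0 <= (l - 1) * n%:Z) = (0 <= l - 1) by nia.
case: l => [[|l]|l].
- by rewrite mul0r expr0z mul1r (_ : (0 <= 0%Z - 1 :> int) = false) // add0r.
- have -> : l.+1%:Z - 1 = l%:Z by lia.
  rewrite -PoszM -exprnP !lez_nat /=.
  by rewrite -exprM [(n * _)%N]mulnC.
- have -> : (0 <= Negz l) = false by lia.
  have -> : (0 <= Negz l - 1) = false by lia.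
  by rewrite mulr0 addr0.
Qed.

(** A binomial over 0 is 1 or 0 according to the sign of [l], so lowering [l] by one changes it only
    at [l = 0]. *)
Lemma gnum0 (x : int) : x != 0 -> gnum x 0 = gnum (x - n%:Z) 0.
Proof.
move=> x0; rewrite /gnum rpredBr ?dvdzz // !gaussl0.
case: (boolP (n%:Z %| x)%Z) => [/dvdzP[l xE]|_] //=.
have l0 : l != 0 by apply: contraNneq x0 => l0; rewrite xE l0 mul0r.
rewrite xE; have -> : l * n%:Z - n%:Z = (l - 1) * n%:Z by ring.
have -> : (0 <= l * n%:Z) = (0 <= l) by nia.
have -> : (0 <= (l - 1) * n%:Z) = (0 <= l - 1) by nia.
by have -> : (0 <= l - 1) = (0 <= l) by lia.
Qed.

Lemma gnum_neq0 (x : int) (m : nat) : gnum x m != 0 -> 0 <= x.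
Proof. by rewrite /gnum; case: ifP => [/andP[]|]; rewrite ?eqxx. Qed.

Definition fterm a v kap m : K :=
  if (n%:Z %| charge kap m)%Z
  then t ^ nexpo a m * \prod_(i < n.-1) gnum (ellnum v m i.+1) (m i) else 0.

Lemma gnum_prod_ge0 v m (s : 'I_n.-1) :
  \prod_(i < n.-1 | i != s) gnum (ellnum v m i.+1) (m i) != 0 ->
  forall i, (i <= n)%N -> i != s.+1 -> 0 <= ellnum v m i.
Proof.
move=> /prodf_neq0 P i le_in i_s.
have [i0|i0] := posnP i; first by rewrite ellnum_edge //; left.
have [lt_in|ge_in] := ltnP i n; last by rewrite ellnum_edge //; right; lia.
have hi : (i.-1 < n.-1)%N by lia.
have := P (Ordinal hi); rewrite /= prednK // => /(_ _)/gnum_neq0; apply.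
by apply/eqP => is_; move: i_s; rewrite -is_ /= prednK ?eqxx.
Qed.

Lemma fterm_ext a v w kap m : (forall i, (0 < i < n)%N -> v i = w i) ->
  fterm a v kap m = fterm a w kap m.
Proof.
move=> vw; rewrite /fterm; case: ifP => // _; congr (_ * _).
apply: eq_bigr => i _; congr gnum; apply: eq_bigr => x _.
by rewrite vw //; have := ltn_ord x; lia.
Qed.

(* Pascal's rule only fails at the binomial of 0 over 0; since
   [(C l)_s = v_s - 2 m_s], this is excluded by [v_s > 0]. *)
Lemma fterm_pascal0 a v kap m (s : 'I_n.-1) : 0 < v s.+1 -> m s = 0%N ->
  fterm a v kap m = fterm a (fun x => v x - Cdl s.+1 x) kap m.
Proof.
move=> v_s ms; rewrite /fterm; case: ifP => // _; congr (_ * _).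
rewrite (bigD1 s) //= [in RHS](bigD1 s) //=.
rewrite [in RHS](eq_bigr (fun i : 'I_n.-1 => gnum (ellnum v m i.+1) (m i))); last first.
  by move=> i /negPf is_; rewrite ellnum_Cdl is_ mulr0 subr0.
set P := \prod_(i < _ | _) _; have [->|P0] := eqVneq P 0; first by rewrite !mulr0.
congr (_ * _); rewrite ellnum_Cdl eqxx mulr1 ms; apply: gnum0.
apply/eqP => L0; have := ellnum_second_difference v m s.
have hs := ltn_ord s.
have := gnum_prod_ge0 P0 (i := s) ltac:(lia) ltac:(lia).
have := gnum_prod_ge0 P0 (i := s.+2) ltac:(lia) ltac:(lia).
rewrite L0 ms; nia.
Qed.

Lemma fterm_eq a v kap m m' : m =1 m' -> fterm a v kap m = fterm a v kap m'.
Proof.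
move=> mm'; rewrite /fterm /charge.
under eq_bigr do rewrite mm'.
case: ifP => // _; congr (t ^ _ * _).
  rewrite /nexpo; congr (_ - _); last by under eq_bigr do rewrite mm'.
  by under eq_bigr => x _ do under eq_bigr do rewrite !mm'.
apply: eq_bigr => i _; rewrite mm'; congr gnum.
by rewrite /ellnum; under eq_bigr do rewrite mm'.
Qed.

Lemma fterm_neq0_ge0 a v kap m : fterm a v kap m != 0 ->
  forall i, (i <= n)%N -> 0 <= ellnum v m i.
Proof.
rewrite /fterm; case: ifP => _; rewrite ?eqxx // mulf_eq0 negb_or => /andP[_].
move=> /prodf_neq0 P i le_in.
have [i0|i0] := posnP i; first by rewrite ellnum_edge //; left.
have [lt_in|ge_in] := ltnP i n; last by rewrite ellnum_edge //; right; lia.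
have hi : (i.-1 < n.-1)%N by lia.
by have := P (Ordinal hi) isT; rewrite /= prednK // => /gnum_neq0.
Qed.

(** In a nonzero term [l_1] and [l_(n-1)] are nonnegative, and their sum is the total of [v - 2 m].
    Hence a box with bound [N] holds the whole support once the total of [v] is at most [2 N]. *)
Lemma fterm_support a v kap m : fterm a v kap m != 0 ->
  2 * \sum_(x < n.-1) (m x)%:Z <= \sum_(x < n.-1) v x.+1.
Proof.
move=> T0; have L1 := fterm_neq0_ge0 T0 (i := 1) ltac:(lia).
have L2 := fterm_neq0_ge0 T0 (i := n.-1) ltac:(lia).
have := ellnum_ends v m; rewrite sumrB -mulr_sumr.
move: (\sum_(x < _) (m x)%:Z) (\sum_(x < _) v x.+1) => M S.
move: L1 L2; move: (ellnum _ _ _) (ellnum _ _ _) => x y; nia.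
Qed.

Definition fsum (N a : nat) v kap : K :=
  \sum_(m : {ffun 'I_n.-1 -> 'I_N.+1}) fterm a v kap (fun i => m i).

Lemma fsum_ext N a v w kap : (forall i, (0 < i < n)%N -> v i = w i) ->
  fsum N a v kap = fsum N a w kap.
Proof. by move=> vw; apply: eq_bigr => m _; apply: fterm_ext. Qed.

Lemma fsum_periodic N a v kap kap' : (n%:Z %| kap - kap')%Z ->
  fsum N a v kap = fsum N a v kap'.
Proof.
move=> dv; apply: eq_bigr => m _; rewrite /fterm; congr (if _ then _ else _).
by rewrite -[LHS](rpredBr _ dv); congr (_ %| _)%Z; rewrite /charge; ring.
Qed.

(** * The value of the fermionic sum at [L = 0] *)

Lemma fterm_base_support j r kap m : (j < n)%N -> (r < n)%N ->
  fterm (n - j) (srcv (n - j) 0 r) kap m != 0 -> (exists x, m x != 0%N) ->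
  [/\ (0 < j)%N, r = (n - j)%N & m =1 (fun x => (x.+1 == r) : nat)].
Proof.
move=> hj hr T0 [s ms]; have hs := ltn_ord s.
have := fterm_support T0.
have -> : \sum_(x < n.-1) srcv (n - j) 0 r x.+1 =
    \sum_(x < n.-1) dl r x.+1 + \sum_(x < n.-1) dl (n - j) x.+1.
  by rewrite -big_split; apply: eq_bigr => x _; rewrite /srcv /=; ring.
(* The source has total at most 2, so the support bound leaves only a unit vector [m = e_(s+1)], and
   both [e_r] and [e_(n-j)] must be nonzero. *)
rewrite !sum_dl (bigD1 s) //=; set M := \sum_(x < _ | _) _ => hM.
have M_ge0 : 0 <= M by apply: sumr_ge0.
have M0 : M = 0 by lia.
have ms1 : m s = 1%N by lia.
have mE : m =1 (fun x => (x == s) : nat).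
  move=> x; case: eqP => [-> //|/eqP xs].
  have /eqP := M0; rewrite psumr_eq0 // => /allP/(_ x).
  by rewrite mem_index_enum xs => /(_ isT)/eqP; lia.
have h1 := fterm_neq0_ge0 T0 (i := 1) ltac:(lia).
have h2 := fterm_neq0_ge0 T0 (i := n.-1) ltac:(lia).
have h3 := fterm_neq0_ge0 T0 (i := s.+1) ltac:(lia).
move: h1 h2 h3; rewrite !(ellnum_unit (s := s)) //; try lia.
move=> h1 h2 h3.
(* The conditions [l_1 >= 0] and [l_(n-1) >= 0] give the two opposite inequalities. *)
have ra : (r + (n - j) = 2 * s.+1)%N.
  move: h1 h2; rewrite ![nCinv _ 1 _]nCinv_le; try lia.
  by rewrite ![nCinv _ n.-1 _]nCinv_ge; lia.
have [rs as_] := nCinv_midpoint (i := s.+1) ltac:(lia) ra ltac:(lia) ltac:(lia) h3.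
split; [lia | by rewrite rs as_ | move=> x].
by rewrite mE rs eqSS.
Qed.

Lemma fsum_base N j r kap : (0 < N)%N -> (j < n)%N -> (r < n)%N ->
  (n%:Z %| j%:Z - 2 * kap - r%:Z)%Z ->
  fsum N (n - j) (srcv (n - j) 0 r) kap = ((n%:Z %| kap) || (n%:Z %| kap - j%:Z))%Z%:R.
Proof.
move=> hN hj hr hrk.
pose m0 : {ffun 'I_n.-1 -> 'I_N.+1} := [ffun => ord0].
have T0 : fterm (n - j) (srcv (n - j) 0 r) kap (fun i => m0 i) = (n%:Z %| kap)%Z%:R.
  rewrite (@fterm_eq _ _ _ _ (fun=> 0%N)) => [|x]; last by rewrite ffunE.
  rewrite /fterm /charge big1 => [|x _]; last by rewrite muln0.
  rewrite addr0; case: ifP => // /dvdzP[c kE].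
  have rj : r = j.
    suff : j%:Z - r%:Z = 0 by lia.
    apply: (@dvdz_small n); try lia.
    have -> : j%:Z - r%:Z = (j%:Z - 2 * kap - r%:Z) + kap * 2 by ring.
    by rewrite rpredD // dvdz_mulr // kE dvdz_mull.
  have -> : nexpo (n - j) (fun=> 0%N) = 0.
    rewrite /nexpo [X in X - _]big1 => [|x _]; last first.
      by apply: big1 => y _; rewrite !mulr0.
    by rewrite big1 ?subr0 // => x _; rewrite mulr0.
  rewrite expr0z mul1r; apply: big1 => i _; have hi := ltn_ord i.
  rewrite /gnum gaussl0.
  have -> : ellnum (srcv (n - j) 0 r) (fun=> 0%N) i.+1 =
      nCinv n i.+1 j + nCinv n i.+1 (n - j).
    rewrite -!(@sum_nCinv_dl n i.+1) //; try lia.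
    by rewrite -big_split; apply: eq_bigr => x _ /=; rewrite /srcv rj; ring.
  (* The minimum is the entry [l_i] for [m = 0]: a nonnegative integer, so the binomial over 0 is
     1. *)
  suff -> : nCinv n i.+1 j + nCinv n i.+1 (n - j) = (minn i.+1 (minn j (minn (n - j) (n - i.+1))))%N%:Z * n%:Z.
    by rewrite dvdz_mull // mulr_ge0.
  have hi' : (i.+1 < n)%N by lia.
  move: (i.+1) hi' => p hp.
  have [pj|pj] := boolP (p <= j)%N; have [pa|pa] := boolP (p <= n - j)%N.
  - have -> : minn p (minn j (minn (n - j) (n - p))) = p by lia.
    by rewrite !nCinv_le; lia.
  - have -> : minn p (minn j (minn (n - j) (n - p))) = (n - j)%N by lia.
    by rewrite nCinv_le ?nCinv_ge; lia.
  - have -> : minn p (minn j (minn (n - j) (n - p))) = j by lia.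
    by rewrite nCinv_ge ?nCinv_le; lia.
  - have -> : minn p (minn j (minn (n - j) (n - p))) = (n - p)%N by lia.
    by rewrite !nCinv_ge; lia.
have [j0|j_gt0] := posnP j.
  rewrite /fsum (bigD1 m0) //= T0 big1 ?addr0 => [|m /eqP m_m0].
    by rewrite j0 subr0 orbb.
  apply/eqP; apply: contraT => /fterm_base_support[] //; last by rewrite j0.
  apply/existsP; apply: contraT; rewrite negb_exists => /forallP mz; case: m_m0.
  by apply/ffunP => x; rewrite ffunE; apply/val_inj/eqP; have := mz x; rewrite negbK.
have hs : ((n - j).-1 < n.-1)%N by lia.
pose s := Ordinal hs.
pose m1 : {ffun 'I_n.-1 -> 'I_N.+1} := [ffun x => inord (x == s)].
have m1E : (fun i => m1 i : nat) =1 (fun x => (x == s) : nat).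
  by move=> x; rewrite ffunE inordK //; case: eqP.
have T1 : fterm (n - j) (srcv (n - j) 0 r) kap (fun i => m1 i) = (n%:Z %| kap - j%:Z)%Z%:R.
  rewrite (fterm_eq _ _ _ m1E) /fterm /charge.
  under eq_bigr do rewrite PoszM.
  rewrite sum_ord_eq /=.
  have -> : kap + (n - j).-1.+1 = (kap - j%:Z) + n%:Z by lia.
  rewrite rpredDr ?dvdzz //; case: ifP => // dk.
  have rj : r = (n - j)%N.
    suff : r%:Z - (n - j)%N%:Z = 0 by lia.
    apply: (@dvdz_small n); try lia.
    have -> : r%:Z - (n - j)%N%:Z = - (j%:Z - 2 * kap - r%:Z) - (kap - j%:Z) * 2 - n%:Z.
      by rewrite -subzn; [ring | lia].
    by rewrite !rpredB ?rpredN ?dvdz_mulr ?dvdzz.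
  have sE : s.+1 = (n - j)%N by rewrite /=; lia.
  have -> : nexpo (n - j) (fun x => (x == s) : nat) = 0.
    rewrite /nexpo sum_ord_eq; apply/eqP; rewrite subr_eq0; apply/eqP.
    under eq_bigr => x _.
      under eq_bigr => y _ do rewrite mulrA.
      rewrite sum_ord_eq; over.
    by rewrite sum_ord_eq sE.
  rewrite expr0z mul1r; apply: big1 => i _; have hi := ltn_ord i.
  rewrite (ellnum_unit (s := s)) //; try lia.
  rewrite sE rj /gnum.
  have -> : forall x : int, x + x - 2 * x = 0 by move=> x; ring.
  by rewrite dvdz0 lexx div0z gauss0m.
have m01 : m1 != m0.
  apply/eqP => /ffunP/(_ s)/(congr1 val) /=.
  by rewrite !ffunE eqxx inordK.
rewrite /fsum (bigD1 m0) //= T0 (bigD1 m1) //= T1 big1 ?addr0 => [|m /andP[/eqP m_m0 /eqP m_m1]].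
  rewrite -natrD; congr (_%:R).
  case: (boolP (n%:Z %| kap)%Z) => // dk; rewrite rpredBl //.
  case: (boolP (n%:Z %| j%:Z)%Z) => // /dvdz_small; lia.
apply/eqP; apply: contraT => /fterm_base_support[] //.
  apply/existsP; apply: contraT; rewrite negb_exists => /forallP mz; case: m_m0.
  by apply/ffunP => x; rewrite ffunE; apply/val_inj/eqP; have := mz x; rewrite negbK.
move=> _ rj mE; case: m_m1; apply/ffunP => x; apply/val_inj.
rewrite /= mE rj; have /= -> := m1E x; rewrite -[x == s]/(x == (n - j).-1 :> nat).
by rewrite -[in RHS]eqSS prednK //; lia.
Qed.

(** * Pascal's rule for the fermionic sum *)

Hypothesis t_neq0 : t != 0.

(** Only the [s]-th binomial is expanded. In its second part [m_s] has dropped by one, which is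
    compensated by [- 2 e_s] in the source and [+ s] in the charge. *)
Lemma fterm_pascalS a v kap m (s : 'I_n.-1) :
  fterm a v kap (incr s m) =
  fterm a (fun x => v x - Cdl s.+1 x) kap (incr s m) +
  t ^ pascal_expo a v s.+1 *
    fterm a (fun x => v x - 2 * dl s.+1 x) (kap + s.+1%:Z) m.
Proof.
rewrite /fterm charge_incr; case: ifP => [_|]; last by rewrite mulr0 addr0.
rewrite (bigD1 s) //= [X in _ * X + _](bigD1 s) //= [in X in _ + X](bigD1 s) //=.
rewrite [X in _ * (_ * X) + _](eq_bigr (fun i : 'I_n.-1 => gnum (ellnum v (incr s m) i.+1) (incr s m i)));
  last by move=> i /negPf is_; rewrite ellnum_Cdl is_ mulr0 subr0.
rewrite [X in _ + _ * (_ * (_ * X))](eq_bigr (fun i : 'I_n.-1 => gnum (ellnum v (incr s m) i.+1) (incr s m i)));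
  last by move=> i /negPf is_; rewrite ellnum_incr /incr is_ addn0.
set P := \prod_(i < _ | _) _.
rewrite ellnum_Cdl eqxx mulr1 -ellnum_incr.
have -> : incr s m s = (m s).+1 by rewrite /incr eqxx addn1.
rewrite gnumS.
suff -> : t ^ pascal_expo a v s.+1 * (t ^ nexpo a m * (gnum (ellnum v (incr s m) s.+1) (m s) * P))
  = t ^ nexpo a (incr s m) * t ^ ellnum v (incr s m) s.+1 * gnum (ellnum v (incr s m) s.+1) (m s) * P.
  by ring.
rewrite !mulrA -!expfzDr //; congr (t ^ _ * _ * _).
rewrite nexpo_incr /pascal_expo (ellnumE v) sum_incr; ring.
Qed.

(* The bound on [v] keeps the support away from the boundary of the box, so that
   the shift of [m_s] may be taken cyclically. *)
Lemma fsum_pascal N a v kap (s : nat) : (0 < s < n)%N -> 0 < v s ->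
  \sum_(x < n.-1) v x.+1 <= 2 * N%:Z ->
  fsum N a v kap = fsum N a (fun x => v x - Cdl s x) kap +
    t ^ pascal_expo a v s * fsum N a (fun x => v x - 2 * dl s x) (kap + s%:Z).
Proof.
case: s => // s /= lt_sn v_s sum_v; have hs : (s < n.-1)%N by lia.
pose o := Ordinal hs.
pose D m := t ^ pascal_expo a v o.+1 *
  fterm a (fun x => v x - 2 * dl o.+1 x) (kap + o.+1%:Z) m.
rewrite /fsum mulr_sumr -[X in _ + X]/(\sum_(m : {ffun 'I_n.-1 -> 'I_N.+1}) D (fun i => m i)).
pose up (m : {ffun 'I_n.-1 -> 'I_N.+1}) :=
  [ffun x => if x == o then ordS (m x) else m x].
pose down (m : {ffun 'I_n.-1 -> 'I_N.+1}) :=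
  [ffun x => if x == o then ord_pred (m x) else m x].
have upK : cancel up down.
  by move=> m; apply/ffunP => x; rewrite !ffunE; case: eqP => // _; rewrite ordSK.
have downK : cancel down up.
  by move=> m; apply/ffunP => x; rewrite !ffunE; case: eqP => // _; rewrite ord_predK.
have up_bij : bijective up by exists down.
(* [h m] is the second Pascal term attached to [m], set to 0 when [m_s = 0], where [fterm_pascal0]
   yields no such term. *)
pose h (m : {ffun 'I_n.-1 -> 'I_N.+1}) :=
  if m o == ord0 then 0 else D (fun i => (m i - (i == o))%N).
have -> : \sum_(m : {ffun 'I_n.-1 -> 'I_N.+1}) D (fun i => m i) = \sum_m h m.
  rewrite [RHS](reindex up) /=; last by apply: onW_bij.
  apply: eq_bigr => m _; rewrite /h ffunE eqxx.
  have [mN|mN] := eqVneq (m o : nat) N.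
    (* Here the shift wraps around to [m_s = 0], where [h] is 0; the term [D] vanishes too, since
       its source has total at most [2 N - 2]. *)
    have -> : ordS (m o) == ord0 by apply/eqP/val_inj => /=; rewrite mN modnn.
    apply/eqP; rewrite mulf_eq0; apply/orP; right; apply: contraT => /fterm_support.
    rewrite sumrB -mulr_sumr.
    have -> : \sum_(x < n.-1) dl o.+1 x.+1 = 1.
      rewrite (bigD1 o) //= /dl eqxx big1 // => x /negPf; rewrite eqSS.
      by rewrite -[x == o]/(x == s :> nat) => ->.
    rewrite (bigD1 o) //= mN.
    have : 0 <= \sum_(i < n.-1 | i != o) (m i)%:Z by apply: sumr_ge0.
    move: (\sum_(i < _ | _) _) => M M_ge0; move: sum_v.
    by move: (\sum_(x < _) v x.+1) => S; lia.
  have lt_mN : ((m o).+1 < N.+1)%N by have := ltn_ord (m o); lia.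
  have -> : (ordS (m o) == ord0) = false by apply/eqP => /(congr1 val) /=; rewrite modn_small.
  congr (_ * _); apply: fterm_eq => x; rewrite ffunE.
  case: eqP => [->|_] /=; last by rewrite subn0.
  by rewrite modn_small // subn1.
rewrite -big_split; apply: eq_bigr => m _; rewrite /h.
case: eqP => [mo|/eqP mo] /=; first by rewrite addr0 -[s]/(o : nat) -fterm_pascal0 // mo.
have mE : (fun i => m i : nat) =1 incr o (fun i => (m i - (i == o))%N).
  move=> x; rewrite /incr; case: eqP => [->|_]; last by rewrite subn0 addn0.
  by rewrite subnK // lt0n; apply: contra mo => /eqP mo; apply/eqP/val_inj.
by rewrite !(fterm_eq _ _ _ mE) fterm_pascalS.
Qed.

(** * The two chains of Pascal steps and the three-term recurrence *)

Lemma fsum_descend N a L r kap : (0 < r < n)%N -> (0 < a <= n)%N -> 1 <= L ->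
  L + 2 <= 2 * N%:Z ->
  fsum N a (srcv a L r) kap = fsum N a (srcv a (L - 1) r.-1) kap +
    \sum_(r <= s < n) t ^ chain_expo L r s * fsum N a (chainv a L r s) (kap + s%:Z).
Proof.
move=> hr ha hL hN.
(* [V (n-1)] and [V (r-1)] are the two sources of the statement, and [V s - C e_s = V (s-1)], so the
   Pascal steps telescope. *)
pose V s : nat -> int := fun i => srcv a (L - 1) r i + dl s i - dl s.+1 i.
have step s : (r <= s < n)%N ->
  fsum N a (V s) kap - fsum N a (V s.-1) kap =
  t ^ chain_expo L r s * fsum N a (chainv a L r s) (kap + s%:Z).
  move=> hs; rewrite (@fsum_pascal N a (V s) kap s); try lia.
  - rewrite (@fsum_ext _ _ _ (V s.-1)) => [|i hi]; last first.
      by rewrite /V /Cdl prednK; [ring | lia].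
    rewrite addrAC subrr add0r; congr (t ^ _ * _); last first.
      by apply: fsum_ext => i hi; rewrite /V /chainv /srcv; ring.
    rewrite pascal_expo_srcv; try lia.
    rewrite /chain_expo [nCinv _ _ r]nCinv_ge ?nCinv_le; try lia.
  - rewrite /V /srcv /dl; lia.
  - rewrite /V /srcv !big_split /= !sumrN -mulr_sumr !sum_dl; lia.
rewrite -(eq_big_nat _ _ step).
have hr' : r.-1.+1 = r by lia.
have hn' : n.-1.+1 = n by lia.
rewrite -[X in index_iota X n]hr' -[X in index_iota _ X]hn' big_add1 /=.
rewrite (eq_bigr (fun s => fsum N a (V s.+1) kap - fsum N a (V s) kap)) //.
rewrite telescope_sumr; last by lia.
rewrite (@fsum_ext _ _ (V n.-1) (srcv a L r)) => [|i hi]; last first.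
  by rewrite /V /srcv hn' (dl_top hi); ring.
rewrite (@fsum_ext _ _ (V r.-1) (srcv a (L - 1) r.-1)) => [|i hi]; last first.
  by rewrite /V /srcv hr'; ring.
by ring.
Qed.

(** A step at [s + 1] with charge [kap - 1] has the same correction source and charge as the step at
    [s] in [fsum_descend]; the exponents differ by the constant [r + 1 - L]. The correction for
    [s = n - 1] is absent here. *)
Lemma fsum_ascend N a L r kap : (0 < r < n)%N -> (0 < a <= n)%N -> 1 <= L ->
  L + 2 <= 2 * N%:Z ->
  t ^ (r%:Z + 1 - L) *
    (fsum N a (srcv a (L - 1) r.+1) (kap - 1) - fsum N a (srcv a (L - 2) r) (kap - 1))
  = \sum_(r <= s < n.-1) t ^ chain_expo L r s * fsum N a (chainv a L r s) (kap + s%:Z).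
Proof.
move=> hr ha hL hN.
pose V s : nat -> int := fun i => srcv a (L - 1) r i + dl s.+1 i - dl s i.
have step s : (r <= s < n.-1)%N ->
  t ^ (r%:Z + 1 - L) * (fsum N a (V s) (kap - 1) - fsum N a (V s.+1) (kap - 1)) =
  t ^ chain_expo L r s * fsum N a (chainv a L r s) (kap + s%:Z).
  move=> hs; rewrite (@fsum_pascal N a (V s) (kap - 1) s.+1); try lia.
  - rewrite (@fsum_ext _ _ _ (V s.+1)) => [|i hi]; last first.
      by rewrite /V /Cdl /=; ring.
    rewrite [X in _ * X = _]addrAC subrr add0r mulrA -expfzDr //; congr (t ^ _ * _); last first.
      have -> : kap - 1 + s.+1%:Z = kap + s%:Z by lia.
      by apply: fsum_ext => i hi; rewrite /V /chainv /srcv; ring.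
    rewrite pascal_expo_srcv; try lia.
    rewrite /chain_expo [nCinv _ _ r]nCinv_ge ?[nCinv _ _ s]nCinv_ge ?nCinv_le; try lia.
  - rewrite /V /srcv /dl; lia.
  - rewrite /V /srcv !big_split /= !sumrN -mulr_sumr !sum_dl; lia.
rewrite -(eq_big_nat _ _ step) -mulr_sumr; congr (_ * _).
rewrite (eq_bigr (fun s => - (fsum N a (V s.+1) (kap - 1) - fsum N a (V s) (kap - 1))));
  last by move=> s _; rewrite opprB.
rewrite sumrN telescope_sumr; last by lia.
rewrite opprB; congr (_ - _); apply: fsum_ext => i hi; rewrite /V /srcv.
  ring.
have -> : n.-1.+1 = n by lia.
by rewrite (dl_top hi); ring.
Qed.

Lemma fsum_recurrence N a L r kap : (0 < r < n)%N -> (0 < a <= n)%N -> 1 <= L ->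
  L + 2 <= 2 * N%:Z ->
  fsum N a (srcv a L r) kap = fsum N a (srcv a (L - 1) r.-1) kap +
    t ^ (r%:Z + 1 - L) * (fsum N a (srcv a (L - 1) r.+1) (kap - 1) +
      (t ^ (n%:Z * (L - 1)) - 1) * fsum N a (srcv a (L - 2) r) (kap - 1)).
Proof.
move=> hr ha hL hN; rewrite fsum_descend //; congr (_ + _).
set A := fsum _ _ _ (kap - 1); set B := fsum _ _ (srcv a (L - 2) r) _.
have -> : t ^ (r%:Z + 1 - L) * (A + (t ^ (n%:Z * (L - 1)) - 1) * B) =
    t ^ (r%:Z + 1 - L) * (A - B) + t ^ (r%:Z + 1 - L) * t ^ (n%:Z * (L - 1)) * B.
  by ring.
rewrite fsum_ascend // -expfzDr //.
have hn' : n.-1.+1 = n by lia.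
rewrite -[X in index_iota _ X]hn' big_nat_recr /=; last by lia.
congr (_ + t ^ _ * _); first by rewrite /chain_expo -subn1 -subzn; [ring | lia].
rewrite (@fsum_periodic _ _ _ _ (kap - 1)).
  by apply: fsum_ext => i hi; rewrite /chainv /srcv hn' (dl_top hi); ring.
have -> : kap + n.-1%:Z - (kap - 1) = n%:Z by lia.
exact: dvdzz.
Qed.

(** Strong induction on the length. Applying the two-term recurrence of [S] at [kap], at the
    reflected parameter [kap2] and at [kap - 1], and eliminating [S L kap2], gives the three-term
    recurrence of [fsum]. *)
Lemma fsum_unique N j (S : nat -> int -> K) : (j < n)%N ->
  (forall kap, S 0%N kap = ((n%:Z %| kap) || (n%:Z %| kap - j%:Z))%Z%:R) ->
  (forall L kap kap', (n%:Z %| kap - kap')%Z -> S L kap = S L kap') ->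
  (forall L kap r, (r < n)%N -> (n%:Z %| L.+1%:Z + j%:Z - 2 * kap - r%:Z)%Z ->
     S L.+1 kap = S L kap +
       (if r == 0%N then 0 else t ^+ (r * L.+1) * S L (j%:Z - kap + L.+1%:Z))) ->
  forall L kap r, (L + 2 <= 2 * N)%N -> (r < n)%N ->
    (n%:Z %| L%:Z + j%:Z - 2 * kap - r%:Z)%Z ->
    S L kap = fsum N (n - j) (srcv (n - j) L%:Z r) kap.
Proof.
have dvdE (x y : int) : x = y -> (n%:Z %| x)%Z -> (n%:Z %| y)%Z by move->.
move=> hj S0 Sper SS; elim/ltn_ind=> -[|L] IH kap r hL hr hrk.
  rewrite fsum_base ?S0 //; first lia.
have [r0|r_gt0] := posnP r.
  (* For [r = 0] one unit of [(L + 1) e_(n-1)] is read as [e_r] with [r = n - 1] at length [L]. *)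
  rewrite (SS _ _ _ hr hrk) r0 addr0 (IH L _ kap n.-1); try lia.
  - apply: fsum_ext => i hi; rewrite /srcv (_ : dl 0 i = 0); first by lia.
    by rewrite /dl; case: eqP hi => //; lia.
  - have -> : L%:Z + j%:Z - 2 * kap - n.-1%:Z = (L.+1%:Z + j%:Z - 2 * kap - r%:Z) - n%:Z by lia.
    by rewrite rpredB ?dvdzz.
rewrite fsum_recurrence //; try lia.
have -> : L.+1%:Z - 1 = L%:Z by lia.
rewrite -(IH L _ kap r.-1); try lia; last first.
  by apply: (dvdE _ _ _ hrk); lia.
have -> : fsum N (n - j) (srcv (n - j) L%:Z r.+1) (kap - 1) = S L (kap - 1).
  have [lt_rn|ge_rn] := ltnP r.+1 n.
    rewrite (IH L _ _ r.+1) //; try lia.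
    by apply: (dvdE _ _ _ hrk); lia.
  have rn : r.+1 = n by lia.
  rewrite (IH L _ _ 0%N); try lia.
    apply: fsum_ext => i hi; rewrite rn /srcv (dl_top hi).
    by rewrite (_ : dl 0 i = 0) // /dl; case: eqP hi => //; lia.
  have -> : L%:Z + j%:Z - 2 * (kap - 1) - 0 = (L.+1%:Z + j%:Z - 2 * kap - r%:Z) + n%:Z by lia.
  by rewrite rpredD ?dvdzz.
rewrite (SS _ _ _ hr hrk) (gtn_eqF r_gt0); congr (_ + _).
case: L IH hL hrk => [|L] IH hL hrk.
  (* At length 1 the factor [t ^ (n (L - 1)) - 1] vanishes and removes the sum of length -1; the
     initial values remain to be compared. *)
  rewrite mulr0 expr0z subrr mul0r addr0 muln1.
  have -> : r%:Z + 1 - 1 = r%:Z by ring.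
  rewrite -exprnP; congr (_ * _); rewrite !S0 orbC; congr ((_ || _)%:R).
    have -> : j%:Z - kap + 1 - j%:Z = - (kap - 1) by ring.
    by rewrite rpredN.
  have -> : j%:Z - kap + 1 = - (kap - 1 - j%:Z) by ring.
  by rewrite rpredN.
have -> : L.+2%:Z - 2 = L%:Z by lia.
rewrite -(IH L _ _ r); try lia; last by apply: (dvdE _ _ _ hrk); lia.
set kap2 := j%:Z - kap + L.+2%:Z.
have dvd2 : (n%:Z %| L.+1%:Z + j%:Z - 2 * kap2 - (n - 1 - r)%N%:Z)%Z.
  have -> : L.+1%:Z + j%:Z - 2 * kap2 - (n - 1 - r)%N%:Z =
    - (L.+2%:Z + j%:Z - 2 * kap - r%:Z) - n%:Z by rewrite /kap2; lia.
  by rewrite rpredB ?rpredN ?dvdzz.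
have lt2 : (n - 1 - r < n)%N by lia.
rewrite (SS L kap2 _ lt2 dvd2).
have -> : j%:Z - kap2 + L.+1%:Z = kap - 1 by rewrite /kap2; lia.
have expoE c d : c = d -> t ^ c = t ^ d by move->.
have [lt_rn|ge_rn] := ltnP r.+1 n; last first.
  (* For [r = n - 1] the parameters [kap2] and [kap - 1] agree modulo [n] and both have residue 0,
     so no elimination takes place. *)
  have rn : r.+1 = n by lia.
  have -> : (n - 1 - r)%N = 0%N by lia.
  have dvd3 : (n%:Z %| kap2 - (kap - 1))%Z.
    have -> : kap2 - (kap - 1) = (L.+2%:Z + j%:Z - 2 * kap - r%:Z) + n%:Z
      by rewrite /kap2; lia.
    by rewrite rpredD ?dvdzz.
  have dvd4 : (n%:Z %| L.+1%:Z + j%:Z - 2 * (kap - 1) - 0%N%:Z)%Z.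
    have -> : L.+1%:Z + j%:Z - 2 * (kap - 1) - 0%N%:Z =
      (L.+2%:Z + j%:Z - 2 * kap - r%:Z) + n%:Z by lia.
    by rewrite rpredD ?dvdzz.
  have n_gt0 : (0 < n)%N by lia.
  rewrite (Sper _ _ _ dvd3) /= addr0 (SS L _ _ n_gt0 dvd4).
  rewrite /= addr0 mulrBl mul1r [_ + (_ - _)]addrC subrK mulrA -expfzDr // exprnP; congr (_ * _).
  by apply: expoE; rewrite -rn; nia.
have -> : (n - 1 - r == 0)%N = false by apply/eqP; lia.
rewrite (SS L (kap - 1) r.+1) //; last first.
  by apply: (dvdE _ _ _ hrk); lia.
have -> : j%:Z - (kap - 1) + L.+1%:Z = kap2 by rewrite /kap2; lia.
rewrite /= !exprnP.
have e1 : t ^ (r * L.+2)%N%:Z = t ^ (r%:Z + 1 - L.+2%:Z) * t ^ (r.+1 * L.+1)%N%:Z.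
  by rewrite -expfzDr //; apply: expoE; lia.
have e2 : t ^ (r * L.+2)%N%:Z * t ^ ((n - 1 - r) * L.+1)%N%:Z =
    t ^ (r%:Z + 1 - L.+2%:Z) * t ^ (n%:Z * L.+1%:Z).
  rewrite -!expfzDr //; apply: expoE; rewrite !PoszM.
  have -> : (n - 1 - r)%N%:Z = n%:Z - 1 - r%:Z by lia.
  have -> : L.+2%:Z = L%:Z + 2 by lia.
  have -> : L.+1%:Z = L%:Z + 1 by lia.
  ring.
rewrite mulrDr mulrA e2 e1; ring.
Qed.

End Fermionic.

(** * The path sum *)

Local Arguments Lam {n} a _.
Local Arguments hat {n} a _.
Local Arguments eqw {n} u v.
Local Arguments addw {n} u v _.
Local Arguments subw {n} u v _.
Local Arguments inP2 {n} w.
Local Arguments wt {n} w _.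
Local Arguments lamx {n L} j k p l _.
Local Arguments is_path {n L} j k p.
Local Arguments mu {n L} j k p l.
Local Arguments Gsize {n L} j k p.

Section Paths.

Variable n : nat.
Hypothesis n_ge2 : (2 <= n)%N.

Lemma LamE (a : int) (i : 'I_n) : Lam a i = (n%:Z %| a - i%:Z)%Z%:Z.
Proof.
rewrite /Lam -eqz_mod_dvd [in RHS]eq_sym (@modz_small i%:Z); last by have := ltn_ord i; lia.
by case: eqP.
Qed.

Lemma Lam_congr (a b : int) : (n%:Z %| a - b)%Z -> Lam (n := n) a =1 Lam b.
Proof.
move=> ab i; rewrite !LamE; congr (nat_of_bool _)%:Z.
by rewrite -[RHS](rpredDl _ ab); congr (_ %| _)%Z; ring.
Qed.

Lemma int_repr (a : int) : exists i : 'I_n, (n%:Z %| a - i%:Z)%Z.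
Proof.
have n0 : n%:Z != 0 by lia.
have hi : (`|(a %% n%:Z)%Z|%N < n)%N.
  have := ltz_pmod a (d := n%:Z) ltac:(lia); have := modz_ge0 a n0; lia.
exists (Ordinal hi) => /=.
rewrite gez0_abs ?modz_ge0 // -eqz_mod_dvd modz_mod //.
Qed.

Lemma ndvd1 : (n%:Z %| 1)%Z = false.
Proof. by rewrite dvdz1; case: n n_ge2 => // -[]. Qed.

Lemma eqwP (u v : 'I_n -> int) : reflect (u =1 v) (eqw u v).
Proof. by apply: (iffP forallP) => uv i; [apply/eqP | rewrite uv]. Qed.

(** For [n >= 2] the coefficient -1 of [hat a] sits exactly at the residue of [a]. *)
Lemma hat_inj (a b : int) : hat (n := n) a =1 hat b -> (n%:Z %| a - b)%Z.
Proof.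
have [i ai] := int_repr a => /(_ i); rewrite /hat !LamE ai.
have -> : a + 1 - i%:Z = (a - i%:Z) + 1 by ring.
rewrite rpredDl // ndvd1 => ab.
have bi : (n%:Z %| b - i%:Z)%Z by move: ab; do 2![case: (_ %| _)%Z].
have -> : a - b = (a - i%:Z) - (b - i%:Z) by ring.
by rewrite rpredB.
Qed.

(* The weight prescribed at position [L] of a path with end parameter [kap]. *)
Definition endw (j : nat) (kap L : int) : 'I_n -> int :=
  addw (Lam kap) (Lam (j%:Z - kap + L)).

Lemma endw_congr j kap kap' L : (n%:Z %| kap - kap')%Z -> endw j kap L =1 endw j kap' L.
Proof.
move=> kk i; rewrite /endw /addw (Lam_congr kk); congr (_ + _); apply: Lam_congr.
have -> : j%:Z - kap + L - (j%:Z - kap' + L) = - (kap - kap') by ring.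
by rewrite rpredN.
Qed.

(** The same two fundamental weights, taken in the other order. *)
Lemma endw_swap j kap kap' L : (n%:Z %| j%:Z - kap + L - kap')%Z ->
  endw j kap L =1 endw j kap' L.
Proof.
move=> kk i; rewrite /endw /addw [RHS]addrC; congr (_ + _); apply: Lam_congr => //.
have -> : kap - (j%:Z - kap' + L) = - (j%:Z - kap + L - kap') by ring.
by rewrite rpredN.
Qed.

Lemma endw_step j kap L : subw (endw j kap (L + 1)) (endw j kap L) =1 hat (j%:Z - kap + L).
Proof. by move=> i; rewrite /subw /endw /addw /hat addrA; ring. Qed.

(* Removing a step from the weight [endw j kap (L + 1)] of level two leaves only
   two possible predecessors, one for each of the two fundamental weights. *)
Lemma endw_pred j kap L (w : 'I_n -> int) (mu : int) : (forall i, 0 <= w i) ->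
  subw (endw j kap (L + 1)) w =1 hat mu ->
  w =1 endw j kap L \/ w =1 endw j (j%:Z - kap + (L + 1)) L.
Proof.
move=> w_ge0 wE; have [i mi] := int_repr (mu + 1).
have mui : (n%:Z %| mu - i%:Z)%Z = false.
  have -> : mu - i%:Z = (mu + 1 - i%:Z) - 1 by ring.
  by rewrite rpredBl // ndvd1.
have wE' x : w x = endw j kap (L + 1) x - hat mu x by rewrite -wE /subw; ring.
have := w_ge0 i; rewrite wE' /endw /addw /hat !LamE mi mui.
case: (boolP (n%:Z %| kap - i%:Z)%Z) => [ki _|_].
  have km : (n%:Z %| kap - (mu + 1))%Z.
    have -> : kap - (mu + 1) = (kap - i%:Z) - (mu + 1 - i%:Z) by ring.
    by rewrite rpredB.
  right=> x; rewrite wE' /endw /addw /hat (Lam_congr km).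
  have -> : j%:Z - (j%:Z - kap + (L + 1)) + L = kap - 1 by ring.
  rewrite (@Lam_congr (kap - 1) mu); first by ring.
  by have -> : kap - 1 - mu = kap - (mu + 1) by ring.
case: (boolP (n%:Z %| j%:Z - kap + (L + 1) - i%:Z)%Z) => [ki _|_ //].
have km : (n%:Z %| j%:Z - kap + (L + 1) - (mu + 1))%Z.
  have -> : j%:Z - kap + (L + 1) - (mu + 1) = (j%:Z - kap + (L + 1) - i%:Z) - (mu + 1 - i%:Z) by ring.
  by rewrite rpredB.
left=> x; rewrite wE' /endw /addw /hat (Lam_congr km).
rewrite (@Lam_congr (j%:Z - kap + L) mu); first by ring.
by have -> : j%:Z - kap + L - mu = j%:Z - kap + (L + 1) - (mu + 1) by ring.
Qed.

(** The two possible predecessors agree only if the residue [r] at length [L + 1] is 0; this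
    separates the two classes of paths in [psumS]. *)
Lemma endw_inj j kap L : endw j kap L =1 endw j (j%:Z - kap + (L + 1)) L ->
  (n%:Z %| j%:Z - 2 * kap + (L + 1))%Z.
Proof.
have [i ki] := int_repr kap => /(_ i); rewrite /endw /addw !LamE ki.
have -> : j%:Z - (j%:Z - kap + (L + 1)) + L - i%:Z = (kap - i%:Z) - 1 by ring.
have -> : (n%:Z %| kap - i%:Z - 1)%Z = false by rewrite rpredBl ?ndvd1.
rewrite addr0 => e.
have e' : (n%:Z %| j%:Z - kap + (L + 1) - i%:Z)%Z.
  by move: e; do 2![case: (_ %| _)%Z].
have -> : j%:Z - 2 * kap + (L + 1) = (j%:Z - kap + (L + 1) - i%:Z) - (kap - i%:Z) by ring.
by rewrite rpredB.
Qed.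

Lemma endw_inP2 j kap L : inP2 (endw j kap L).
Proof.
have [a ha] := int_repr kap; have [b hb] := int_repr (j%:Z - kap + L).
apply/existsP; exists a; apply/existsP; exists b; apply/eqwP => i.
by rewrite /endw /addw (Lam_congr ha) (Lam_congr hb).
Qed.

Definition endc (j : nat) (kap L : int) : wcode n :=
  [ffun i => inord `|endw j kap L i|%N].

Lemma wt_endc j kap L : wt (endc j kap L) =1 endw j kap L.
Proof.
move=> i; rewrite /wt ffunE.
have h : 0 <= endw j kap L i < 3.
  by rewrite /endw /addw !LamE; do 2![case: (_ %| _)%Z].
by rewrite inordK; lia.
Qed.

Lemma wt_inj (c d : wcode n) : wt c =1 wt d -> c = d.
Proof. by move=> cd; apply/ffunP => i; apply/val_inj; have [] := cd i. Qed.

Lemma mu_eq L j k (p : pcode n L) l (a : int) :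
  subw (lamx j k p l.+1) (lamx j k p l) =1 hat a ->
  (n%:Z %| (mu j k p l)%:Z - a)%Z.
Proof.
move=> h; rewrite /mu; case: pickP => [m /eqwP hm|none].
  by apply: hat_inj => i; rewrite -hm h.
have [m ma] := int_repr a; have /eqwP[] := none m => i; rewrite h.
have am1 : (n%:Z %| a + 1 - (m%:Z + 1))%Z.
  by have -> : a + 1 - (m%:Z + 1) = a - m%:Z by ring.
by rewrite /hat (Lam_congr ma) (Lam_congr am1).
Qed.

(** * Appending a last weight to a path *)

Section Extension.

Variables (L j k : nat).

Definition extp (p : pcode n L) (c : wcode n) : pcode n L.+1 :=
  [ffun l : 'I_L.+2 => if (l <= L)%N then p (inord l) else c].

Definition resp (p : pcode n L.+1) : pcode n L := [ffun l : 'I_L.+1 => p (inord l)].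

Lemma respK p : extp (resp p) (p ord_max) = p.
Proof.
apply/ffunP => l; rewrite !ffunE; case: ifP => lL.
  by congr (p _); apply: val_inj; rewrite /= !inordK //; have := ltn_ord l; lia.
by congr (p _); apply: val_inj => /=; have := ltn_ord l; lia.
Qed.

Lemma extpK p c : resp (extp p c) = p.
Proof.
apply/ffunP => l; have hl := ltn_ord l; rewrite !ffunE inordK; last by lia.
by rewrite -ltnS hl inord_val.
Qed.

Lemma lamx_extp p c l k' : (l <= L)%N -> lamx j k (extp p c) l = lamx j k' p l.
Proof.
move=> lL; rewrite /lamx lL leqW // ffunE inordK; last by lia.
by rewrite lL.
Qed.

Lemma lamx_extp_last p c : lamx j k (extp p c) L.+1 = wt c.
Proof. by rewrite /lamx leqnn ffunE inordK // ltnn. Qed.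

Lemma lamx_out M (p : pcode n M) k' : lamx j k' p M.+1 =1 endw j k' (M%:Z + 1).
Proof. by move=> i; rewrite /lamx ltnn /endw addrA. Qed.

Lemma lamx_ge0 M (p : pcode n M) k' l i : (l <= M)%N -> 0 <= lamx j k' p l i.
Proof. by move=> lM; rewrite /lamx lM. Qed.

Lemma is_path_end M k' (p : pcode n M) : is_path j k' p -> lamx j k' p M =1 endw j k' M%:Z.
Proof. by case/and4P => _ _ _ /eqwP. Qed.

(** The appended weight is the conventional weight that [p] already has at position [L + 1], so no
    earlier step changes. *)
Lemma mu_extp (p : pcode n L) (k' l : nat) : endw j k' L.+1%:Z =1 endw j k L.+1%:Z ->
  (l <= L)%N -> mu j k (extp p (endc j k L.+1%:Z)) l = mu j k' p l.
Proof.
move=> kE lL; rewrite /mu.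
have E : eqw (subw (lamx j k (extp p (endc j k L.+1%:Z)) l.+1) (lamx j k (extp p (endc j k L.+1%:Z)) l))
   =1 eqw (subw (lamx j k' p l.+1) (lamx j k' p l)).
  move=> v; rewrite (@lamx_extp p _ l k') //; apply/idP/idP => /eqwP h; apply/eqwP => i; rewrite -h /subw; congr (_ - _).
    have [lL'|lL'] := ltnP l L; first by rewrite (@lamx_extp _ _ _ k').
    have -> : l = L by lia.
    by rewrite lamx_extp_last lamx_out wt_endc -kE; congr endw; lia.
  have [lL'|lL'] := ltnP l L; first by rewrite (@lamx_extp _ _ _ k').
  have -> : l = L by lia.
  by rewrite lamx_extp_last lamx_out wt_endc -kE; congr endw; lia.
by under eq_pick do rewrite E.
Qed.

(** The last two steps are [j - k' + L] and [j - k + L + 1] modulo [n], so the only possible new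
    wall, at [L + 1], has height [k' - k = r]; there is none if [r = 0]. *)
Lemma Gsize_extp (p : pcode n L) (k' r : nat) : is_path j k' p ->
  endw j k' L.+1%:Z =1 endw j k L.+1%:Z -> (r < n)%N ->
  (n%:Z %| k'%:Z - k%:Z - r%:Z)%Z ->
  Gsize j k (extp p (endc j k L.+1%:Z)) = (Gsize j k' p + r * L.+1)%N.
Proof.
move=> hp kE hr rE; rewrite /Gsize big_nat_recr //=; congr (_ + _)%N.
  apply: eq_big_nat => x hx; apply: eq_bigl => h.
  by rewrite !(mu_extp _ kE) //; lia.
rewrite (@mu_extp p k' L kE (leqnn L)).
have d1 : (n%:Z %| (mu j k (extp p (endc j k L.+1%:Z)) L.+1)%:Z - (j%:Z - k%:Z + L.+1%:Z))%Z.
  apply: mu_eq => i; rewrite -endw_step /subw lamx_extp_last lamx_out wt_endc.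
  by [].
have d2 : (n%:Z %| (mu j k' p L)%:Z - (j%:Z - k'%:Z + L%:Z))%Z.
  by apply: mu_eq => i; rewrite -endw_step /subw lamx_out (is_path_end hp).
set M1 := (mu _ _ _ L.+1)%:Z in d1 *; set M2 := (mu _ _ _ L)%:Z in d2 *.
have hE h : (M1 - M2 == h%:Z + 1 %[mod n%:Z])%Z = (n%:Z %| r%:Z - h%:Z)%Z.
  rewrite eqz_mod_dvd.
  have -> : M1 - M2 - (h%:Z + 1) = (r%:Z - h%:Z) + ((M1 - (j%:Z - k%:Z + L.+1%:Z))
     - (M2 - (j%:Z - k'%:Z + L%:Z)) + (k'%:Z - k%:Z - r%:Z)) by lia.
  by rewrite rpredDr // rpredD // rpredB.
under eq_bigl do rewrite hE.
have [r0|r_gt0] := posnP r.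
  rewrite r0 mul0n big_nat_cond big1 // => h; rewrite sub0r => /andP[/andP[h1 h2]].
  by rewrite rpredN => /dvdz_small; lia.
have hr' : (1 <= r < n)%N by rewrite r_gt0.
rewrite big_mkcond (bigD1_seq r) ?mem_index_iota ?iota_uniq //= subrr dvdz0.
rewrite big1_seq ?addn0 // => h /andP[h_r]; rewrite mem_index_iota => hh.
by case: ifP => // /dvdz_small; move/eqP: h_r; lia.
Qed.

Variable k2 : nat.
Hypothesis k2E : (n%:Z %| k2%:Z - (j%:Z - k%:Z + L.+1%:Z))%Z.

Lemma endw_k2 : endw j k2 L.+1%:Z =1 endw j k L.+1%:Z.
Proof.
apply: endw_swap; have -> : j%:Z - k2%:Z + L.+1%:Z - k%:Z = - (k2%:Z - (j%:Z - k%:Z + L.+1%:Z)) by ring.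
by rewrite rpredN.
Qed.

(** The end condition fixes [c], and [endw_pred] leaves two end weights for [p], those with
    parameters [k] and [k2]. Conversely both parameters prescribe the same weight at [L + 1]. *)
Lemma is_path_extp (p : pcode n L) c : is_path j k (extp p c) =
  (c == endc j k L.+1%:Z) && (is_path j k p || is_path j k2 p).
Proof.
apply/idP/andP => [/and4P[/forallP inP /forallP steps /eqwP start /eqwP last]|].
  have cE : c = endc j k L.+1%:Z.
    by apply: wt_inj => i; rewrite wt_endc -(lamx_extp_last p c) -[endw _ _ _ _]last.
  split; first by rewrite cE.
  have hP : [forall l : 'I_L.+1, inP2 (wt (p l))].
    apply/forallP => l; have hl := ltn_ord l.
    have := inP (widen_ord (leqnSn _) l); rewrite ffunE /= -ltnS hl.
    by have -> : inord l = l by apply/val_inj; rewrite /= inordK.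
  have hS k' : [forall l : 'I_L, [exists mu : 'I_n,
      eqw (subw (lamx j k' p l.+1) (lamx j k' p l)) (hat mu)]].
    apply/forallP => l; have hl := ltn_ord l.
    have := steps (widen_ord (leqnSn _) l).
    by rewrite /= !(@lamx_extp _ _ _ k') //; lia.
  have h0 k' : eqw (lamx j k' p 0) (addw (Lam 0) (Lam j%:Z)).
    by apply/eqwP => i; rewrite -(@lamx_extp _ c _ k').
  have /existsP[m /eqwP] := steps ord_max.
  rewrite /= lamx_extp_last (@lamx_extp _ _ _ k) // => hm.
  have [] := @endw_pred j k L%:Z (lamx j k p L) m.
  - by move=> i; apply: lamx_ge0.
  - by move=> i; rewrite -hm /subw cE wt_endc -[in RHS]addn1 PoszD.
  - by move=> hk; apply/orP; left; rewrite /is_path hP hS h0; apply/eqwP.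
  - move=> hk; apply/orP; right; rewrite /is_path hP hS h0; apply/eqwP => i.
    have -> : lamx j k2 p L = lamx j k p L by rewrite /lamx leqnn.
    rewrite hk.
    apply/esym/endw_congr; have -> // : L%:Z + 1 = L.+1%:Z by lia.
case=> /eqP -> /orP hp.
have [k' hk' kE] : exists2 k' : nat, is_path j k' p & endw j k' L.+1%:Z =1 endw j k L.+1%:Z.
  by case: hp => hp; [exists k | exists k2 => //; apply: endw_k2].
have pL := is_path_end hk'.
case/and4P: hk' => /forallP inP /forallP steps /eqwP start _.
apply/and4P; split.
- apply/forallP => l; rewrite ffunE; case: ifP => // _.
  have := endw_inP2 j k L.+1%:Z => /existsP[a /existsP[b /eqwP h]].
  by apply/existsP; exists a; apply/existsP; exists b; apply/eqwP => i; rewrite wt_endc h.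
- apply/forallP => l; have hl := ltn_ord l.
  have [lL|lL] := ltnP l L.
    by have := steps (Ordinal lL); rewrite /= !(@lamx_extp _ _ _ k') //; lia.
  have -> : l = L :> nat by lia.
  have [m hm] := int_repr (j%:Z - k'%:Z + L%:Z).
  apply/existsP; exists m; apply/eqwP => i.
  rewrite lamx_extp_last (@lamx_extp _ _ _ k') // /subw wt_endc -kE pL.
  have -> : L.+1%:Z = L%:Z + 1 by lia.
  rewrite -[LHS]/(subw _ _ i) endw_step /hat (Lam_congr hm).
  congr (_ - _); apply: Lam_congr.
  by have -> : j%:Z - k'%:Z + L%:Z + 1 - (m%:Z + 1) = j%:Z - k'%:Z + L%:Z - m%:Z by ring.
- by apply/eqwP => i; rewrite (@lamx_extp _ _ _ k') // start.
- by apply/eqwP => i; rewrite lamx_extp_last wt_endc.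
Qed.

End Extension.

(** * The generating function of paths and its recurrence in the length *)

Definition resn (kap : int) : nat := `|(kap %% n%:Z)%Z|%N.

Lemma resnP kap : (n%:Z %| kap - (resn kap)%:Z)%Z.
Proof.
by rewrite /resn gez0_abs ?modz_ge0 -?eqz_mod_dvd ?modz_mod //; lia.
Qed.

Lemma resn_congr kap kap' : (n%:Z %| kap - kap')%Z -> resn kap = resn kap'.
Proof. by rewrite -eqz_mod_dvd /resn => /eqP ->. Qed.

Variables (K : fieldType) (t : K) (j : nat).

Definition psum (L : nat) (kap : int) : K :=
  \sum_(p : pcode n L | is_path j (resn kap) p) t ^+ Gsize j (resn kap) p.

Lemma psum_congr L kap kap' : (n%:Z %| kap - kap')%Z -> psum L kap = psum L kap'.
Proof. by move=> /resn_congr; rewrite /psum => ->. Qed.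

Lemma psum0 kap : psum 0 kap = ((n%:Z %| kap) || (n%:Z %| kap - j%:Z))%Z%:R.
Proof.
have kE := resnP kap; rewrite /psum; set k := resn kap in kE *.
pose p0 : pcode n 0 := [ffun => endc j k 0].
have pE (p : pcode n 0) : is_path j k p =
    (p == p0) && ((n%:Z %| kap) || (n%:Z %| kap - j%:Z))%Z.
  have lE k' : lamx j k' p 0 = wt (p ord0).
    by rewrite /lamx /=; congr (wt (p _)); apply: val_inj; rewrite /= inordK.
  apply/idP/andP => [h|[/eqP pE hk]].
    have hL := is_path_end h; case/and4P: h => _ _ /eqwP h0 _; split.
      apply/eqP/ffunP => l; rewrite ffunE (ord1 l); apply: wt_inj => i.
      by rewrite wt_endc -hL lE.
    have [i ki] := int_repr kap; have := hL i; rewrite h0 /endw /addw !LamE.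
    have -> : (n%:Z %| k%:Z - i%:Z)%Z.
      have -> : k%:Z - i%:Z = (kap - i%:Z) - (kap - k%:Z) by ring.
      by rewrite rpredB.
    case: (boolP (n%:Z %| 0 - i%:Z)%Z) => [i0 _|_].
      have -> : kap = (kap - i%:Z) - (0 - i%:Z) by ring.
      by rewrite rpredB.
    case: (boolP (n%:Z %| j%:Z - i%:Z)%Z) => [ji _|_]; last by case: (_ %| _)%Z.
    have -> : kap - j%:Z = (kap - i%:Z) - (j%:Z - i%:Z) by ring.
    by rewrite [X in _ || X]rpredB ?orbT.
  have eE : endw j k 0 =1 addw (Lam 0) (Lam j%:Z).
    move=> i; have -> : endw j k 0 i = endw j kap 0 i.
      by apply/esym/endw_congr.
    have -> : addw (Lam 0) (Lam j%:Z) i = endw j 0 0 i by rewrite /endw subr0 addr0.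
    case/orP: hk => hk; first by apply: endw_congr; rewrite subr0.
    apply: endw_swap.
    have -> : j%:Z - kap + 0 - 0 = - (kap - j%:Z) by ring.
    by rewrite rpredN.
  have wE : wt (p ord0) =1 endw j k 0 by move=> i; rewrite pE ffunE wt_endc.
  apply/and4P; split.
  - apply/forallP => l; rewrite (ord1 l).
    have := endw_inP2 j k 0 => /existsP[a /existsP[b /eqwP h]].
    by apply/existsP; exists a; apply/existsP; exists b; apply/eqwP => i; rewrite wE h.
  - by apply/forallP => -[].
  - by apply/eqwP => i; rewrite lE wE eE.
  - by apply/eqwP => i; rewrite lE wE.
under eq_bigl do rewrite pE.
case: (_ || _); last by rewrite big_pred0 // => p; rewrite andbF.
under eq_bigl do rewrite andbT.
by rewrite big_pred1_eq /Gsize big_geq.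
Qed.

(** Paths are split by the end parameter left after removing the last weight: [k] creates no wall,
    while [k2] creates one of height [r] at [L + 1]. For [r = 0] the two classes coincide. *)
Lemma psumS L kap r : (r < n)%N -> (n%:Z %| L.+1%:Z + j%:Z - 2 * kap - r%:Z)%Z ->
  psum L.+1 kap = psum L kap +
    (if r == 0%N then 0 else t ^+ (r * L.+1) * psum L (j%:Z - kap + L.+1%:Z)).
Proof.
move=> hr hrk; rewrite /psum; have kE := resnP kap.
have := resnP (j%:Z - kap + L.+1%:Z).
set k := resn kap in kE *; set k2 := resn (j%:Z - kap + L.+1%:Z) => kE2.
have k2E : (n%:Z %| k2%:Z - (j%:Z - k%:Z + L.+1%:Z))%Z.
  have -> : k2%:Z - (j%:Z - k%:Z + L.+1%:Z) =
    - (j%:Z - kap + L.+1%:Z - k2%:Z) - (kap - k%:Z) by ring.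
  by rewrite rpredB ?rpredN.
have k2r : (n%:Z %| k2%:Z - k%:Z - r%:Z)%Z.
  have -> : k2%:Z - k%:Z - r%:Z = (L.+1%:Z + j%:Z - 2 * kap - r%:Z)
    - (j%:Z - kap + L.+1%:Z - k2%:Z) + (kap - k%:Z) by ring.
  by apply: rpredD => //; apply: rpredB.
have n_gt0 : (0 < n)%N by lia.
set c0 := endc j k L.+1%:Z.
rewrite (reindex_onto (fun p => extp p c0) (@resp L)) /=; last first.
  move=> p; rewrite -{1}(respK p) (is_path_extp k2E) => /andP[/eqP pc _].
  by rewrite /c0 -pc respK.
under eq_bigl => p do rewrite (is_path_extp k2E) !eqxx extpK eqxx andbT /=.
have G1 (p : pcode n L) : is_path j k p -> Gsize j k (extp p c0) = Gsize j k p.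
  move=> hp; rewrite /c0 (Gsize_extp hp _ n_gt0) ?mul0n ?addn0 //.
  by rewrite subrr subr0 dvdz0.
have G2 (p : pcode n L) : is_path j k2 p -> Gsize j k (extp p c0) = (r * L.+1 + Gsize j k2 p)%N.
  by move=> hp; rewrite /c0 (Gsize_extp hp _ hr k2r) 1?addnC //; apply: endw_k2.
have [r0|r_neq0] := eqVneq r 0%N.
  have -> : k2 = k.
    have -> : k = resn k by rewrite -(resn_congr kE).
    rewrite /k2 (resn_congr kE2); apply: resn_congr.
    by have := k2r; rewrite r0 subr0.
  under eq_bigl do rewrite orbb.
  by rewrite addr0; apply: eq_bigr => p /G1 ->.
rewrite (bigID (fun p => is_path j k p)) /=; congr (_ + _).
  apply: eq_big => [p|p]; first by rewrite andb_orl andbb andbC orb_idr // => /andP[].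
  by move=> /andP[_] /G1 ->.
rewrite mulr_sumr; apply: eq_big => [p|p]; last first.
  by move=> /andP[/orP[h|/G2 -> _]]; rewrite ?h // exprD.
(* A path in both classes would force [r = 0] by [endw_inj]. *)
rewrite andb_orl andbN /=; apply: andb_idr => h2; apply/negP => h1.
have : endw j k L%:Z =1 endw j (j%:Z - k%:Z + (L%:Z + 1)) L%:Z.
  move=> i; rewrite -(is_path_end h1).
  have -> : lamx j k p L = lamx j k2 p L by rewrite /lamx leqnn.
  rewrite (is_path_end h2); apply: endw_congr.
  by have <- : L.+1%:Z = L%:Z + 1 by lia.
move/endw_inj => e; case/eqP: r_neq0.
suff : r%:Z = 0 by lia.
apply: (@dvdz_small n); try lia.
have -> : r%:Z = (j%:Z - 2 * k%:Z + (L%:Z + 1)) + (k2%:Z - (j%:Z - k%:Z + L.+1%:Z)) - (k2%:Z - k%:Z - r%:Z) by lia.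
by apply: rpredB => //; apply: rpredD.
Qed.

End Paths.

(** * Transfer to coefficients *)

Lemma qpochS N : qpoch N.+1 = qpoch N * (1 - 'X^(N.+1)).
Proof. by rewrite /qpoch big_nat_recr. Qed.

Lemma qpoch_neq0 N : qpoch N != 0.
Proof.
elim: N => [|N IH]; first by rewrite /qpoch big_geq ?oner_eq0.
rewrite qpochS mulf_neq0 // -opprB oppr_eq0 -size_poly_gt0.
by rewrite size_XnsubC.
Qed.

Lemma gauss_qpoch l m : gauss 'X l m * (qpoch l * qpoch m) = qpoch (l + m).
Proof.
have q0 : qpoch 0 = 1 by rewrite /qpoch big_geq.
elim: l m => [|l IHl] m; first by rewrite gauss0m q0 !mul1r.
elim: m => [|m IHm]; first by rewrite gaussl0 q0 addn0 mulr1 mul1r.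
rewrite gaussSS addnS [in RHS]qpochS.
have IH1 := IHl m.+1; rewrite addnS -addSn in IH1.
have -> : 'X^((l.+1 + m).+1) = 'X^(l.+1) * 'X^(m.+1) :> {poly rat} by rewrite -exprD addnS.
(* This splitting of the last factor matches the two terms of Pascal's rule. *)
have -> : qpoch (l.+1 + m) * (1 - 'X^(l.+1) * 'X^(m.+1)) =
  qpoch (l.+1 + m) * (1 - 'X^(l.+1)) + 'X^(l.+1) * (qpoch (l.+1 + m) * (1 - 'X^(m.+1))) by ring.
rewrite -{1}IH1 -IHm !qpochS; ring.
Qed.

Lemma qbin_gauss l m : qbin (l + m) m = gauss 'X l m.
Proof.
rewrite /qbin leq_addl addnK -gauss_qpoch [qpoch m * _]mulrC mulpK //.
by rewrite mulf_neq0 ?qpoch_neq0.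
Qed.

Section Transfer.

Variable n : nat.
Hypothesis n_ge2 : (2 <= n)%N.

Let nQ_neq0 : n%:R != 0 :> rat. Proof. by rewrite pnatr_eq0; lia. Qed.

Lemma CartanE (x z : 'I_n.-1) : Cartan n x z = (Cdl x.+1 z.+1)%:~R.
Proof.
rewrite mxE /Cdl /dl /= !eqSS -[x == z]/(x == z :> nat).
have [xz|/eqP xz] := eqVneq (x : nat) z.
  have -> : (z.+1 == x :> nat) = false by apply/eqP; lia.
  have -> : (z == x.+1 :> nat) = false by apply/eqP; lia.
  by [].
rewrite [z == x.+1 :> nat]eq_sym.
have [xz'|_] /= := eqVneq x.+1 z; last by case: (_ == _).
by have -> : (z.+1 == x :> nat) = false by apply/eqP; lia.
Qed.

Lemma CinvE (a b : 'I_n.-1) : Cinv n a b = (nCinv n a.+1 b.+1)%:~R / n%:R.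
Proof.
pose B : 'M[rat]_(n.-1) := \matrix_(a, b) ((nCinv n a.+1 b.+1)%:~R / n%:R).
suff CB : Cartan n *m B = 1%:M.
  have [Cu _] := mulmx1_unit CB.
  (* A right inverse makes the square matrix invertible, so [invmx] is its true inverse. *)
  by rewrite /Cinv -[invmx _]mulmx1 -CB mulmxA mulVmx // mul1mx mxE.
apply/matrixP => x y; rewrite !mxE; have hx := ltn_ord x; have hy := ltn_ord y.
have -> : \sum_z Cartan n x z * B z y =
    (\sum_(z < n.-1) nCinv n y.+1 z.+1 * Cdl x.+1 z.+1)%:~R / n%:R.
  rewrite rmorph_sum mulr_suml; apply: eq_bigr => z _.
  by rewrite CartanE mxE nCinvC rmorphM /= mulrA [_%:~R * _%:~R]mulrC.
have -> : \sum_(z < n.-1) nCinv n y.+1 z.+1 * Cdl x.+1 z.+1 = n%:Z * dl x.+1 y.+1.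
  rewrite -nCinv_Cartan; try lia.
  rewrite -!(@sum_nCinv_dl n y.+1); try lia.
  by rewrite mulr_sumr -!sumrB; apply: eq_bigr => z _; rewrite /Cdl /=; ring.
rewrite rmorphM /= mulrAC mulfV // mul1r /dl eqSS eq_sym.
by rewrite -[x == y]/(x == y :> nat); case: (_ == _).
Qed.

Lemma ellvE L j r m (i : 'I_n.-1) :
  ellv n L j r m i ord0 = (ellnum (srcv n (n - j) L%:Z r) m i.+1)%:~R / n%:R.
Proof.
rewrite /ellv mxE /ellnum rmorph_sum mulr_suml; apply: eq_bigr => x _.
rewrite CinvE !mxE rmorphM /= mulrAC; congr (_ * _ * _).
rewrite /srcv /dl !rmorphB !rmorphD !rmorphM /=.
by do 3![case: (_ == _) => //=]; ring.
Qed.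

Lemma expoE j m : expo n j m = (nexpo (n - j) m)%:~R / n%:R.
Proof.
rewrite /expo !mxE /nexpo rmorphB mulrBl /=; congr (_ - _).
  rewrite rmorph_sum mulr_suml /=.
  under eq_bigr do rewrite !mxE mulr_suml.
  rewrite exchange_big; apply: eq_bigr => x _ /=.
  rewrite rmorph_sum mulr_suml; apply: eq_bigr => y _.
  by rewrite !mxE CinvE !rmorphM /=; ring.
have -> : \sum_(x < n.-1) nCinv n x.+1 (n - j) * (m x)%:Z =
    \sum_(x < n.-1) \sum_(y < n.-1) nCinv n x.+1 y.+1 * dl (n - j) y.+1 * (m x)%:Z.
  apply: eq_bigr => x _; have hx := ltn_ord x.
  by rewrite -mulr_suml sum_nCinv_dl //; lia.
rewrite rmorph_sum mulr_suml /=.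
under eq_bigr do rewrite !mxE mulr_suml.
rewrite exchange_big; apply: eq_bigr => x _ /=.
rewrite rmorph_sum mulr_suml; apply: eq_bigr => y _.
by rewrite !mxE CinvE !rmorphM /= /dl; case: (_ == _); rewrite ?mulr1z ?mulr0z; ring.
Qed.

(* The variable ['X] of the fraction field stands for [q^(1/n)]. *)
Definition substX (p : {poly rat}) : {fraction {poly rat}} := tofrac (p \Po 'X^n).

Definition tX : {fraction {poly rat}} := tofrac 'X.

Lemma tX_neq0 : tX != 0.
Proof. by rewrite tofrac_eq0 polyX_eq0. Qed.

Lemma substX_gauss l m : substX (gauss 'X l m) = gauss (tX ^+ n) l m.
Proof.
rewrite /substX -[_ \Po _]/(comp_poly 'X^n _) !rmorph_gauss.
by rewrite /= comp_polyX rmorphXn.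
Qed.

(** The default values match: a natural top entry below [m] means negative [x / n], and a top entry
    that is not natural means that [x / n] is no nonnegative integer. *)
Lemma substX_qbinQ (x : int) m : substX (qbinQ (x%:~R / n%:R + m%:R) m) = gnum n tX x m.
Proof.
have n_gt0 : 0 < n%:R :> rat by rewrite ltr0n; lia.
rewrite /gnum; case: ifP => [/andP[/dvdzP[l ->] l_ge0]|hx].
  have l_ge0' : 0 <= l by nia.
  rewrite mulzK; last by lia.
  case: l l_ge0' {l_ge0} => // l _ /=.
  rewrite rmorphM /= mulfK // -natrD /qbinQ natr_nat natrK qbin_gauss.
  exact: substX_gauss.
rewrite /qbinQ; case: ifP => [/natrP[N NE]|_]; last by rewrite /substX comp_poly0 rmorph0.
rewrite NE natrK /qbin; case: leqP => [le_mN|_]; last by rewrite /substX comp_poly0 rmorph0.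
case/negP: hx; have xE : x = (N - m)%N%:Z * n%:Z.
  have : x%:~R = (N - m)%N%:R * n%:R :> rat.
    by rewrite natrB // -NE addrK divfK.
  by rewrite -natrM pmulrn => /intr_inj ->; rewrite PoszM.
by rewrite xE dvdz_mull //=; apply: mulr_ge0.
Qed.

Lemma fterm_substX L j k r m : fterm tX (n - j) (srcv n (n - j) L%:Z r) k%:Z m =
  if ((k + \sum_(i < n.-1) i.+1 * m i) %% n == 0)%N
  then tX ^ nexpo (n - j) m * substX (qprod n L j r m) else 0.
Proof.
rewrite /fterm; have -> : charge k%:Z m = (k + \sum_(i < n.-1) i.+1 * m i)%N%:Z.
  rewrite /charge PoszD; congr (_ + _).
  by rewrite (big_morph Posz PoszD (erefl _)).
rewrite -[(_ %| _)%Z]/(n %| _)%N /dvdn; case: ifP => // _; congr (_ * _).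
rewrite /qprod /substX -[_ \Po _]/(comp_poly 'X^n _) !rmorph_prod.
by apply: eq_bigr => i _; rewrite ellvE -substX_qbinQ.
Qed.

(** * Coefficients at rational powers of [q] *)

(** The coefficient of [q^e] in [q^(w/n) p(q)]. *)
Definition qcoef (w : int) (p : {poly rat}) (e : rat) : rat :=
  let d := e - w%:~R / n%:R in
  if d \is a Num.nat then p`_(Num.truncn d) else 0.

Lemma qcoefE (M : nat) (w : int) p e : 0 <= w + M%:Z -> qcoef w p e =
  if n%:R * e + M%:R \is a Num.nat
  then ('X^(absz (w + M%:Z)) * (p \Po 'X^n))`_(Num.truncn (n%:R * e + M%:R)) else 0.
Proof.
move=> wM; have n_gt0 : (0 < n)%N by lia.
have wE : w = (absz (w + M%:Z))%:Z - M%:Z by lia.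
set W := absz _ in wE *; clearbody W; subst w => {wM}.
rewrite /qcoef; set d := e - _.
have eE : n%:R * e + M%:R = n%:R * d + W%:R.
  by rewrite /d rmorphB /= mulrBr mulrCA mulfV // mulr1; ring.
rewrite eE; clearbody d; case: ifP => [/natrP[c ->]|hd].
  rewrite -natrM -natrD natr_nat !natrK coefXnM ltnNge leq_addl /= addnK.
  by rewrite coef_comp_poly_Xn // dvdn_mulr // mulKn.
case: ifP => // /natrP[c cE]; rewrite cE natrK coefXnM; case: ltnP => // le_Wc.
rewrite coef_comp_poly_Xn //; case: ifP => // /dvdnP[f fE].
case/negP: (negbT hd); have -> : d = f%:R.
  have : n%:R * d = (f * n)%N%:R by rewrite -fE natrB // -cE addrK.
  by rewrite natrM [f%:R * _]mulrC => /(mulfI nQ_neq0).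
exact: natr_nat.
Qed.

Lemma qcoef_sum (I J : finType) (P : pred I) (Q : pred J) (w : I -> int) (w' : J -> int)
    (p : I -> {poly rat}) (p' : J -> {poly rat}) e :
  \sum_(i | P i) tX ^ w i * substX (p i) = \sum_(i | Q i) tX ^ w' i * substX (p' i) ->
  \sum_(i | P i) qcoef (w i) (p i) e = \sum_(i | Q i) qcoef (w' i) (p' i) e.
Proof.
(* Multiplication by [tX ^ M] makes every exponent nonnegative, so the identity descends from the
   fraction field to polynomials. *)
pose M := (\sum_i `|w i| + \sum_i `|w' i|)%N.
have wM i : 0 <= w i + M%:Z by rewrite /M (bigD1 i) //=; lia.
have wM' i : 0 <= w' i + M%:Z by rewrite /M (bigD1 (i : J)) //=; lia.
have shift (w0 : int) q : 0 <= w0 + M%:Z ->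
    tX ^+ M * (tX ^ w0 * substX q) = tofrac ('X^(absz (w0 + M%:Z)) * (q \Po 'X^n)).
  move=> h; rewrite exprnP mulrA -expfzDr ?tX_neq0 // tofracM tofracXn.
  by rewrite exprnP gez0_abs // addrC.
move/(congr1 ( *%R (tX ^+ M))); rewrite !mulr_sumr.
under eq_bigr do rewrite shift //.
under [RHS]eq_bigr do rewrite shift //.
rewrite -!rmorph_sum => /eqP; rewrite tofrac_eq => /eqP E.
under eq_bigr do rewrite (@qcoefE M) //.
under [RHS]eq_bigr do rewrite (@qcoefE M) //.
case: (_ \is a _); last by rewrite !big1.
by rewrite -!coef_sum E.
Qed.

End Transfer.

Theorem theorem3 (n L j k r : nat) :
  (2 <= n)%N -> (j < n)%N -> (k < n)%N -> (1 <= r <= n)%N ->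
  ((L%:Z + j%:Z - 2 * k%:Z) = r%:Z %[mod n%:Z])%Z ->
  forall e : rat, exists N0 : nat, forall N : nat, (N0 <= N)%N ->
    RHS_box_coef n L j k r N e = FL_coef n L j k e.
Proof.
(* A box of size [N + 1 >= L + 3] satisfies [L + 2 <= 2 N], the support bound for a source of total
   at most [L + 2]. *)
move=> n_ge2 hj hk hr hrk e; exists L.+3 => -[//|N] hN.
have resk : resn n k%:Z = k by rewrite /resn modz_small //; lia.
have E : psum n tX j L k%:Z = fsum n tX N (n - j) (srcv n (n - j) L%:Z r) k%:Z.
  move/eqP: hrk; rewrite eqz_mod_dvd => hrk.
  have uniq := fsum_unique n_ge2 tX_neq0 hj (psum0 n_ge2 _ j) (@psum_congr n _ tX j)
    (@psumS n n_ge2 _ tX j).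
  have [lt_rn|ge_rn] := ltnP r n; first by apply: uniq => //; lia.
  have rn : r = n by lia.
  (* The value [r = n] corresponds to the residue 0, and [e_n] and [e_0] both vanish on the indices
     from 1 to [n - 1]. *)
  rewrite (uniq N L _ 0%N); try lia.
    apply: (fsum_ext n_ge2) => i hi; rewrite rn /srcv (dl_top hi).
    by rewrite (_ : dl 0 i = 0) // /dl; case: eqP hi => //; lia.
  have -> : L%:Z + j%:Z - 2 * k%:Z - 0%N%:Z = (L%:Z + j%:Z - 2 * k%:Z - r%:Z) + n%:Z by lia.
  by rewrite rpredD ?dvdzz.
have F : \sum_(p : pcode n L | is_path j k p)
      tX ^ (Gsize j k p)%:Z * substX n 1 =
    \sum_(m : {ffun 'I_n.-1 -> 'I_N.+1} |
          ((k + \sum_(i < n.-1) i.+1 * m i) %% n == 0)%N)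
      tX ^ nexpo (n - j) (fun i => m i : nat) * substX n (qprod n L j r (fun i => m i : nat)).
  rewrite [RHS]big_mkcond; move: E; rewrite /psum resk /fsum.
  under [X in _ = X]eq_bigr do rewrite fterm_substX //.
  move <-; apply: eq_bigr => p _.
  by rewrite -exprnP /substX comp_polyC rmorph1 mulr1.
have := qcoef_sum n_ge2 e F => {F}; rewrite /RHS_box_coef => F.
transitivity (\sum_(p : pcode n L | is_path j k p) qcoef n (Gsize j k p)%:Z 1 e).
  rewrite F; apply: eq_bigr => m _.
  by rewrite /term_coef /qcoef expoE.
rewrite /FL_coef natr_sum [RHS]big_mkcondr; apply: eq_bigr => p _.
rewrite /qcoef; case: eqP => [->|ne].
  by rewrite subrr (natr_nat _ 0) (natrK 0) coef1.
case: ifP => // /natrP[[|c] cE]; last by rewrite cE natrK coef1.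
by case: ne; apply/esym/subr0_eq.
Qed.
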